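(* Let $H\in(0,1)$, $\alpha>0$, let $S_H$ be a sub-fractional Brownian motion with index $H$, and let $S_H^{\mathrm{LT}}(t)=e^{-\alpha H t}S_H(e^{\alpha t})$ for $t\in\mathbb{R}$. Then $S_H^{\mathrm{LT}}$ is an ergodic and strongly mixing stationary Gaussian process. Moreover, its $\alpha$-mixing coefficient $$\alpha_S(h):=\sup\Bigl\{\bigl|\mathbb{P}(A\cap B)-\mathbb{P}(A)\mathbb{P}(B)\bigr|:\ A\in\sigma\{S_H^{\mathrm{LT}}(t):t\le0\},\ B\in\sigma\{S_H^{\mathrm{LT}}(t):t\ge h\}\Bigr\}$$ satisfies, for some constant $C>0$, $$\alpha_S(h)\le C e^{-\alpha H h},\qquad h\to\infty$$ (i.e. for all sufficiently large $h$). In particular, the explicit exponential mixing rate (the exponent in this bound) is $\lambda_S(H,\alpha)=\alpha H$.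
   Context: A sub-fractional Brownian motion $S_H=\{S_H(t)\}_{t\ge 0}$ with index $H\in(0,1)$ is a centred Gaussian process with covariance $$\mathbb{E}[S_H(s)S_H(t)]=s^{2H}+t^{2H}-\tfrac12\bigl((s+t)^{2H}+|t-s|^{2H}\bigr),\qquad s,t\ge0.$$ Strongly mixing means that the $\alpha$-mixing coefficient tends to $0$ as $h\to\infty$. *)

(* Defs.v *)
From HB Require Import structures.
From mathcomp Require Import all_boot all_order all_algebra.
From mathcomp Require Import all_classical all_reals all_analysis.
From mathcomp Require Import measurable_realfun.

Set Implicit Arguments.
Unset Strict Implicit.
Unset Printing Implicit Defensive.

Import Order.TTheory GRing.Theory Num.Theory.
Import numFieldNormedType.Exports.

Local Open Scope classical_set_scope.
Local Open Scope ring_scope.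

Section process.
Context (R : realType) (d : measure_display) (T : measurableType d)
  (P : probability T R).

(* [normal_prob m 0] is by convention the uniform law on [0, 1], so the
   degenerate Gaussian laws are given separately, as Dirac masses. *)
Definition gaussian_law (mu : set R -> \bar R) : Prop :=
  (exists m : R, forall B : set R, measurable B -> mu B = \d_m B) \/
  (exists m s : R, 0 < s /\
     forall B : set R, measurable B -> mu B = normal_prob m s B).

Definition gaussian_process (I : Type) (X : I -> {RV P >-> R}) : Prop :=
  forall (n : nat) (t : 'I_n -> I) (a : 'I_n -> R),
    gaussian_law (pushforward P (fun w => \sum_(i < n) a i * X (t i) w)).

Definition centred (I : Type) (X : I -> {RV P >-> R}) : Prop :=
  forall t, ('E_P[X t] = 0)%E.

Definition stationary (X : R -> {RV P >-> R}) : Prop :=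
  forall (n : nat) (t : 'I_n -> R) (h : R) (B : set (n.-tuple R)),
    measurable B ->
    P [set w | B [tuple X (t i + h) w | i < n]] =
    P [set w | B [tuple X (t i) w | i < n]].

Definition sigma_of (I : Type) (X : I -> {RV P >-> R}) (D : set I) :
    set (set T) :=
  <<s \bigcup_(t in D) preimage_set_system setT (X t) measurable >>.

(* The product sigma-algebra on the path space [R -> R]. *)
Definition cylinder : set (set (R -> R)) :=
  <<s \bigcup_(t in [set: R])
        preimage_set_system setT (fun x : R -> R => x t) measurable >>.

Definition time_shift (h : R) (x : R -> R) : R -> R := fun t => x (t + h).

Definition sample_path (X : R -> {RV P >-> R}) (w : T) : R -> R := fun t => X t w.

(* Invariance has to be understood almost surely: a set of the product
   sigma-algebra depends on countably many coordinates only, so that the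
   strictly invariant ones are just the empty set and the whole space. *)
Definition ergodic (X : R -> {RV P >-> R}) : Prop :=
  forall A : set (R -> R), cylinder A ->
    (forall h : R, P (sample_path X @^-1`
                     (A `+` (time_shift h @^-1` A))) = 0%E) ->
    P (sample_path X @^-1` A) = 0%E \/ P (sample_path X @^-1` A) = 1%E.

Definition alpha_mixing (X : R -> {RV P >-> R}) (h : R) : \bar R :=
  ereal_sup [set r : \bar R | exists A B : set T,
    [/\ sigma_of X [set t | t <= 0] A,
        sigma_of X [set t | h <= t] B &
        r = `|P (A `&` B) - P A * P B|%E]].

Definition strongly_mixing (X : R -> {RV P >-> R}) : Prop :=
  alpha_mixing X h @[h --> +oo] --> 0%E.

Definition sub_fbm_cov (H s t : R) : R :=
  s `^ (2 * H) + t `^ (2 * H) -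
  2^-1 * ((s + t) `^ (2 * H) + `|t - s| `^ (2 * H)).

Definition sub_fbm (H : R) (S : {nonneg R} -> {RV P >-> R}) : Prop :=
  [/\ gaussian_process S,
      centred S &
      forall s t : {nonneg R},
        ('E_P[S s \* S t] = (sub_fbm_cov H s%:num t%:num)%:E)%E].

(* The Lamperti transform; [scale_mfun k f] is [fun w => f w * k]. *)
Definition lamperti (H alpha : R) (S : {nonneg R} -> {RV P >-> R}) (t : R) :
    {RV P >-> R} :=
  scale_mfun (expR (- (alpha * H * t))) (S (expR (alpha * t))%:nng).

End process.

Definition lambda_S (R : realType) (H alpha : R) : R := alpha * H.

(* Main.v *)
Require Import Defs.
From HB Require Import structures.
From mathcomp Require Import all_boot all_order all_algebra.
From mathcomp Require Import all_classical all_reals all_analysis.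
From mathcomp Require Import measurable_realfun.
From mathcomp Require Import ring lra.
Import Order.TTheory GRing.Theory Num.Theory.
Import numFieldNormedType.Exports.
Local Open Scope classical_set_scope.
Local Open Scope ring_scope.

(** Write K_H for the covariance of S_H. Up to a constant factor, K_H(s, t) is
   the integral of (1 - cos(s e^y)) (1 - cos(t e^y)) e^(-2Hy) over all real y,
   and K_(1/2) = min. Hence, by Cauchy-Schwarz, every linear form L in the
   process satisfies |L(min(., u))| <= N u^(1-H) sqrt(Var L). Since the process
   is invariant, up to scaling, under time inversion, the same holds for forms
   in the inverse times. Let U be a form in times s <= 1 and V a form in times
   t >= T. With x = s / t <= 1 / T, the kernel is t^(2H) times
   x^(2H) + (1 - ((1 + x)^(2H) + (1 - x)^(2H)) / 2). The first term is
   a product, whose factors are again forms applied to some min(., u), up to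
   time inversion, and a Taylor expansion of the second one in s and in 1/t has
   a kernel which is a combination of functions min(., v). So
   |Cov(U, V)| <= C T^(-H) sqrt(Var U Var V).

   Such a bound on linear correlations passes to trigonometric polynomials in
   centred Gaussian variables: expanding their covariance in powers of the
   covariance of the variables, each power obeys the same bound by Schur's
   product theorem. Trigonometric polynomials are L^2-dense among the events,
   which bounds the mixing coefficient; the same approximation reduces
   stationarity to that of the covariance, and yields ergodicity. *)

Set Implicit Arguments.
Unset Strict Implicit.
Unset Printing Implicit Defensive.

(** * Linear forms *)

(** Mixing needs a correlation bound uniform over all linear forms, so decay of the covariance at
    pairs of times is not enough: the cross covariance has to be reduced to functions on which a
    form is controlled by its variance alone. The functions min(., u) serve for this because the
    weight e^(-y) of index 1/2 is the product of e^(-Hy), which is absorbed by the variance of the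
    form, and e^(-(1-H)y), which yields the factor u^(1-H). The rate is set by the product term: on
    times t >= T the constant 1 equals T^(-1) min(t, T), which costs T^(-1) T^(1-H) = T^(-H), while
    the Taylor remainder contributes only T^(H-2). With T = e^(alpha h), the factor T^(-H) becomes
    e^(-alpha H h).

    For the passage to trigonometric polynomials, the bound is carried as 2 Cov(U, V) <= rho (Var U
    + Var V). This is linear in the covariances, hence stable under expectations, nonnegative
    combinations and limits. *)

Definition lin {R : ringType} {I : Type} (l : seq (R * I)) (x : I -> R) : R :=
  \sum_(p <- l) p.1 * x p.2.

Section lin.
Context {R : comRingType} {I : eqType}.
Implicit Types (l : seq (R * I)) (x y : I -> R).

Lemma lin_nil x : lin [::] x = 0. Proof. exact: big_nil. Qed.

Lemma lin_cons p l x : lin (p :: l) x = p.1 * x p.2 + lin l x.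
Proof. exact: big_cons. Qed.

Lemma lin_cat l l' x : lin (l ++ l') x = lin l x + lin l' x.
Proof. exact: big_cat. Qed.

Lemma lin_map {J : Type} (f : R * J -> R * I) (m : seq (R * J)) x :
  lin (map f m) x = \sum_(p <- m) (f p).1 * x (f p).2.
Proof. exact: big_map. Qed.

Lemma eq_lin l x y : {in l, forall p, x p.2 = y p.2} -> lin l x = lin l y.
Proof. by move=> xy; apply: eq_big_seq => p /xy ->. Qed.

Lemma linD l x y : lin l (fun i => x i + y i) = lin l x + lin l y.
Proof. by rewrite -big_split; apply: eq_bigr => p _; rewrite mulrDr. Qed.

Lemma linZ l a x : lin l (fun i => a * x i) = a * lin l x.
Proof. by rewrite mulr_sumr; apply: eq_bigr => p _; rewrite mulrCA. Qed.

Lemma linN l x : lin l (fun i => - x i) = - lin l x.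
Proof. by rewrite -sumrN; apply: eq_bigr => p _; rewrite mulrN. Qed.

Lemma linB l x y : lin l (fun i => x i - y i) = lin l x - lin l y.
Proof. by rewrite linD linN. Qed.

Lemma linZr l a x : lin l (fun i => x i * a) = lin l x * a.
Proof. by rewrite mulr_suml; apply: eq_bigr => p _; rewrite mulrA. Qed.

End lin.

Section lin_exchange.
Context {R : comRingType} {I J : eqType}.

Lemma exchange_lin (l : seq (R * I)) (m : seq (R * J)) (k : I -> J -> R) :
  lin l (fun i => lin m (k i)) = lin m (fun j => lin l (k^~ j)).
Proof.
rewrite /lin; under eq_bigr do rewrite mulr_sumr.
rewrite exchange_big; apply: eq_bigr => p _; rewrite mulr_sumr.
by apply: eq_bigr => q _; rewrite mulrCA.
Qed.

Lemma linM (l : seq (R * I)) (m : seq (R * J)) x y :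
  lin l x * lin m y = lin l (fun i => lin m (fun j => x i * y j)).
Proof. by rewrite -linZr; apply: eq_lin => p _; rewrite linZ. Qed.

End lin_exchange.

(** * Integrability and integrals of linear combinations *)

Section integrable_EFin.
Context {R : realType} d {T : measurableType d}.
Variables (mu : {measure set T -> \bar R}) (D : set T).
Hypothesis mD : measurable D.
Implicit Types f g : T -> R.

Lemma integrable_EFinZ a f : mu.-integrable D (EFin \o f) ->
  mu.-integrable D (EFin \o (fun x => a * f x)).
Proof. exact: (@integrableZl _ _ _ mu D mD a). Qed.

Lemma integrable_EFinD f g :
  mu.-integrable D (EFin \o f) -> mu.-integrable D (EFin \o g) ->
  mu.-integrable D (EFin \o (fun x => f x + g x)).
Proof. exact: (@integrableD _ _ _ mu D mD). Qed.

Lemma integrable_EFinB f g :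
  mu.-integrable D (EFin \o f) -> mu.-integrable D (EFin \o g) ->
  mu.-integrable D (EFin \o (fun x => f x - g x)).
Proof. exact: (@integrableB _ _ _ mu D mD). Qed.

Lemma integrable_EFin_le f g : measurable_fun D f ->
    (forall x, D x -> `|f x| <= g x) ->
  mu.-integrable D (EFin \o g) -> mu.-integrable D (EFin \o f).
Proof.
move=> mf fg; apply: le_integrable => //; first exact/measurable_EFinP.
by move=> x Dx; rewrite lee_fin (le_trans (fg x Dx))// ler_norm.
Qed.

End integrable_EFin.

Lemma integrable_lin {R : realType} d (T : measurableType d) (I : eqType)
    (mu : {measure set T -> \bar R}) (D : set T)
    (l : seq (R * I)) (g : I -> T -> R) : measurable D ->
    {in l, forall p, mu.-integrable D (EFin \o g p.2)} ->
  mu.-integrable D (EFin \o (fun w => lin l (fun i => g i w))).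
Proof.
move=> mD; elim: l => [_|p m IH igm].
  by rewrite (_ : _ \o _ = cst 0%E) ?integrable0//; apply/funext => w /=; rewrite lin_nil.
rewrite (_ : (fun w => _) = (fun w => p.1 * g p.2 w + lin m (g^~ w))); last first.
  by apply/funext => w /=; rewrite lin_cons.
apply: integrable_EFinD => //.
  by apply: integrable_EFinZ => //; apply: igm; rewrite mem_head.
by apply: IH => q qm; apply: igm; rewrite inE qm orbT.
Qed.

Lemma Rintegral_lin (R : realType) d (T : measurableType d) (I : eqType)
    (mu : {measure set T -> \bar R}) (D : set T)
    (l : seq (R * I)) (g : I -> T -> R) : measurable D ->
    {in l, forall p, mu.-integrable D (EFin \o g p.2)} ->
  (\int[mu]_(w in D) lin l (fun i => g i w) = lin l (fun i => \int[mu]_(w in D) g i w))%R.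
Proof.
move=> mD; elim: l => [_|p m IH igm].
  rewrite lin_nil; under eq_Rintegral do rewrite lin_nil.
  by rewrite /Rintegral integral0.
have igm' : {in m, forall p, mu.-integrable D (EFin \o g p.2)}.
  by move=> q qm; apply: igm; rewrite inE qm orbT.
under eq_Rintegral do rewrite lin_cons.
rewrite RintegralD//.
- by rewrite lin_cons IH// RintegralZl// igm ?mem_head.
- by apply: integrable_EFinZ => //; apply: igm; rewrite mem_head.
- exact: integrable_lin.
Qed.

(** * Spectral representation of the covariance *)

Section laplace.
Context {R : realType}.
Local Notation mu := (@lebesgue_measure R).

(** By symmetry the integral is twice the one over the half-line, where the integrand is 1/k times
    the exponential density. This is the dominating function for the spectral integrals. *)
Lemma integrable_expR_norm (k : R) : 0 < k ->
  mu.-integrable setT (EFin \o (fun y => expR (- (k * `|y|)))).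
Proof.
move=> k0.
have cf : continuous (fun y : R => expR (- (k * `|y|))).
  move=> y; apply: continuous_comp; last exact: continuous_expR.
  by apply: cvgN; apply: cvgMr; exact: norm_continuous.
have mf := continuous_measurable_fun cf.
apply/integrableP; split; first exact/measurable_EFinP.
under eq_integral do rewrite /= ger0_norm ?expR_ge0//.
rewrite ge0_symfun_integralT//=; last first.
  by move=> y /=; rewrite normrN.
rewrite lte_mul_pinfty//.
have m0 : measurable [set x : R | 0 <= x].
  by rewrite -set_itvcy; exact: measurable_itv.
have me : measurable_fun setT (EFin \o (fun y => k^-1 * exponential_pdf k y)).
  by apply/measurable_EFinP; apply: measurable_funM => //;
    exact: measurable_exponential_pdf.
have e0 y : (0 <= (k^-1 * exponential_pdf k y)%:E)%E.
  by rewrite lee_fin mulr_ge0 ?invr_ge0 ?exponential_pdf_ge0 ?ltW.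
apply: (@le_lt_trans _ _ (\int[mu]_y (k^-1 * exponential_pdf k y)%:E)%E).
  apply: (@le_trans _ _
    (\int[mu]_(y in [set x | (0 <= x)%R]) (k^-1 * exponential_pdf k y)%:E)%E).
    apply: ge0_le_integral => //.
    - by apply/measurable_EFinP; exact: measurable_funTS.
    - exact: measurable_funTS.
    - move=> y y0; rewrite lee_fin exponential_pdfE// mulrA mulVf ?gt_eqF//.
      by rewrite mul1r ger0_norm// mulNr.
  by apply: ge0_subset_integral => //.
under eq_integral do rewrite EFinM.
rewrite integralZl//; last exact: integrable_exponential_pdf.
by rewrite integral_exponential_pdf// mule1 ltry.
Qed.

End laplace.

Section sin_bounds.
Context {R : realType}.
Implicit Types x : R.

Lemma sin_le_norm x : `|sin x| <= `|x|.
Proof.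
wlog x0 : x / 0 <= x => [h|].
  have [|/ltW x0] := leP 0 x; first exact: h.
  by rewrite -normrN -sinN -[`|x|]normrN h// oppr_ge0.
have [|c _] := @MVT_segment R sin cos 0 x x0 (fun y _ => is_derive_sin y).
  by apply: continuous_subspaceT; exact: continuous_sin.
rewrite sin0 !subr0 => ->; rewrite normrM ler_piMl//; exact: cos_max.
Qed.

Lemma onem_cos_le_sqr x : 1 - cos x <= x ^+ 2.
Proof.
rewrite (_ : x = (x / 2) *+ 2); last by rewrite -mulr_natr divfK.
rewrite cos_mulr2n cos2sin2; have := sin_le_norm (x / 2).
move: (x / 2) => z; rewrite -ler_sqr ?nnegrE// !real_normK ?num_real//.
have := sqr_ge0 z; nra.
Qed.

End sin_bounds.

Section oscillation.
Context {R : realType}.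
Local Notation mu := (@lebesgue_measure R).
Implicit Types (p x y : R).

(** Frequencies are parametrised as e^y, so that scaling [x] becomes a translation of [y] and the
    spectral weight is a plain exponential. *)
Definition osc x y : R := 1 - cos (x * expR y).

Definition osc_moment p : R := \int[mu]_y (osc 1 y * expR (- (p * y))).

Lemma osc_ge0 x y : 0 <= osc x y. Proof. by rewrite subr_ge0 cos_le1. Qed.

(** The right-hand side has the shape of [sub_fbm_cov], with [osc _ y] in place of the power
    |.|^(2H); integrating against the weight turns one into the other. *)
Lemma oscM s t y :
  osc s y * osc t y = osc s y + osc t y - 2^-1 * (osc (s + t) y + osc (t - s) y).
Proof.
rewrite /osc [(s + t) * _]mulrDl [(t - s) * _]mulrBl cosD cosB; set a := cos _; set b := cos _.
set c := sin _; set d := sin _; by field.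
Qed.

Lemma osc_norm x y : osc `|x| y = osc x y.
Proof.
by rewrite /osc; have [x0|x0] := ger0P x => //; rewrite mulNr cosN.
Qed.

Lemma continuous_osc x p : continuous (fun y => osc x y * expR (- (p * y))).
Proof.
move=> y; apply: cvgM.
  apply: cvgB; first exact: cvg_cst.
  apply: continuous_comp; last exact: continuous_cos.
  by apply: cvgMr; exact: continuous_expR.
apply: continuous_comp; last exact: continuous_expR.
by apply: cvgN; apply: cvgMr; exact: cvg_id.
Qed.

Lemma integrable_osc x p : 0 < p -> p < 2 ->
  mu.-integrable setT (EFin \o (fun y => osc x y * expR (- (p * y)))).
Proof.
(* For y >= 0, [osc] is at most 2 and e^(-py) decays at rate p; for y < 0, the bound x^2 e^(2y)
   leaves decay at rate 2 - p. *)
move=> p0 p2; pose k := Num.min p (2 - p).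
have k0 : 0 < k by rewrite lt_min p0 subr_gt0.
apply: (@integrable_EFin_le _ _ _ mu _ measurableT _ (fun y => (2 + x ^+ 2) * expR (- (k * `|y|)))) => //.
- by apply: continuous_measurable_fun; exact: continuous_osc.
- move=> y _; rewrite ger0_norm ?mulr_ge0 ?osc_ge0 ?expR_ge0//.
  have [y0|y0] := ger0P y.
    apply: ler_pM => //; rewrite ?osc_ge0 ?expR_ge0//.
      by rewrite /osc; have := cos_geN1 (x * expR y); have := sqr_ge0 x; lra.
    by rewrite ler_expR lerN2 ler_wpM2r// ge_min lexx.
  apply: (@le_trans _ _ (x ^+ 2 * expR (2 * y) * expR (- (p * y)))).
    rewrite ler_wpM2r ?expR_ge0// (le_trans (onem_cos_le_sqr _))//.
    by rewrite exprMn -expRM_natl mulr_natl.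
  rewrite -mulrA -expRD; apply: ler_pM; rewrite ?sqr_ge0 ?expR_ge0//.
    by lra.
  have : k <= 2 - p by rewrite ge_min lexx orbT.
  rewrite ler_expR; nra.
- by apply: integrable_EFinZ => //; exact: integrable_expR_norm.
Qed.

(** Translating [y] by ln |x| absorbs |x| into the exponential and produces |x|^p. The case x = 0,
    where no such translation exists, is treated apart. *)
Lemma Rintegral_osc x p : 0 < p -> p < 2 ->
  \int[mu]_y (osc x y * expR (- (p * y))) = `|x| `^ p * osc_moment p.
Proof.
move=> p0 p2; under eq_Rintegral do rewrite -osc_norm.
have := normr_ge0 x; rewrite le_eqVlt => /predU1P[<-|].
  rewrite powR0 ?gt_eqF// mul0r /Rintegral integral0_eq// => y _.
  by rewrite /osc mul0r cos0 subrr mul0r.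
move: (`|x| : R) => {}x x0.
have dF : (fun y : R => y + ln x)^`()%classic = cst 1.
  by apply/funext => y; rewrite derive1E derive_val addr0.
rewrite -RintegralZl//; last exact: integrable_osc.
congr fine; rewrite [RHS](@increasing_ge0_integration_by_substitutionT _
  (fun y => y + ln x) (fun y => x `^ p * (osc 1 y * expR (- (p * y))))).
- apply: eq_integral => y _; congr EFin.
  rewrite dF !fctE /= mulr1 /osc mul1r expRD lnK ?posrE//.
  rewrite /powR gt_eqF// mulrDr opprD expRD [x * _]mulrC.
  rewrite mulrCA [X in _ = _ * X]mulrA [expR _ * expR _]mulrC -[X in _ = _ * X]mulrA.
  by rewrite -expRD subrr expR0 mulr1.
- by move=> a b ab; rewrite ltrD2r.
- by rewrite dF; exact: cst_continuous.
- by rewrite dF; exact: is_cvg_cst.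
- by rewrite dF; exact: is_cvg_cst.
- by move=> y; exact: ex_derive.
- exact: cvg_addrr_Ny.
- exact: cvg_addrr.
- by move=> y; apply: cvgMr; exact: continuous_osc.
- by move=> y; rewrite !mulr_ge0 ?powR_ge0 ?osc_ge0 ?expR_ge0.
Qed.

(** On [-1, 0] one has 1 - cos(e^y) >= 1 - cos(e^(-1)) > 0 and e^(-py) >= 1, and this interval has
    length 1. *)
Lemma osc_moment_gt0 p : 0 < p -> p < 2 -> 0 < osc_moment p.
Proof.
move=> p0 p2; have int := integrable_osc 1 p0 p2.
have c1 : 0 < 1 - cos (expR (-1)) :> R.
  have e1 : expR (-1) <= 1 :> R by rewrite expR_le1; lra.
  rewrite subr_gt0 -[ltRHS]cos0 ltr_cos ?expR_gt0// ?in_itv/= ?lexx ?pi_ge0//.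
  by rewrite expR_ge0 (le_trans e1)//; have := @pi_ge2 R; lra.
apply: (lt_le_trans c1).
apply: (@le_trans _ _ (\int[mu]_(y in `[(-1)%R, 0%R]) (1 - cos (expR (-1))))).
  have mu1 : mu `[(-1)%R, 0%R]%classic = 1%E.
    by rewrite lebesgue_measure_itv/= lte_fin ltrN10 add0e opprK.
  by rewrite Rintegral_cst// [X in fine X]mu1 mulr1.
have intA : mu.-integrable `[(-1)%R, 0%R] (EFin \o (fun y => osc 1 y * expR (- (p * y)))).
  by apply: integrableS int.
apply: (@le_trans _ _ (\int[mu]_(y in `[(-1)%R, 0%R]) (osc 1 y * expR (- (p * y))))).
  apply: le_Rintegral => //.
    exact/continuous_compact_integrable/continuous_subspaceT/cst_continuous/segment_compact.
  move=> y; rewrite /= in_itv/= => /andP[y1 y0]; rewrite -[leLHS]mulr1.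
  apply: ler_pM; rewrite ?ler01 ?(ltW c1)//.
    rewrite lerB// mul1r; move: y1; rewrite le_eqVlt => /predU1P[<-//|y1].
    have pi2 := @pi_ge2 R.
    have e1 z : z <= 0 -> expR z <= pi :> R.
      by move=> z0; rewrite (@le_trans _ _ 1) ?expR_le1//; lra.
    by rewrite ltW// ltr_cos ?in_itv/= ?expR_ge0 ?e1 ?ltr_expR// lerN10.
  by rewrite -[leLHS]expR0 ler_expR oppr_ge0 pmulr_rle0.
rewrite /Rintegral fine_le//; [exact: integrable_fin_num|exact: integrable_fin_num|].
apply: ge0_subset_integral => //.
  exact: (measurable_int mu).
by move=> y _; rewrite lee_fin mulr_ge0 ?osc_ge0 ?expR_ge0.
Qed.

End oscillation.

Lemma discriminant_le (R : realFieldType) (a x b : R) :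
  (forall t, 0 <= a - 2 * t * x + t ^+ 2 * b) -> x ^+ 2 <= a * b.
Proof.
move=> h; have [b0|b0|b0] := ltgtP b 0.
- have b'0 : 0 < - b by rewrite oppr_gt0.
  (* With t >= 1 and t(-b) larger than |a| + 2|x|, the value a - 2tx + t^2 b is negative, which
     rules out b < 0. *)
  pose t := (`|a| + 2 * `|x| + 1) / - b + 1.
  have t1 : 1 <= t.
    by rewrite lerDr divr_ge0 ?ltW// ?addr_ge0 ?mulr_ge0 ?normr_ge0.
  have : t * - b = `|a| + 2 * `|x| + 1 - b by rewrite /t mulrDl divfK ?gt_eqF// mul1r.
  have := h t; have := ler_norm a; have := ler_norm (- x); rewrite normrN.
  have := normr_ge0 x; have := normr_ge0 a.
  move: t1 b0; move: (`|a|) (`|x|) => na nx; clearbody t => *; exfalso; nra.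
- have := h (x / b); rewrite -(pmulr_rge0 _ b0).
  rewrite (_ : b * _ = a * b - x ^+ 2); first by rewrite subr_ge0.
  by field; rewrite gt_eqF.
- subst b; rewrite mulr0; have [->|x0] := eqVneq x 0; first by rewrite expr0n.
  have := h ((a + 1) / (2 * x)); rewrite mulr0 addr0.
  rewrite (_ : 2 * _ * x = a + 1); first by move=> ?; exfalso; lra.
  by field.
Qed.

Lemma Rintegral_cauchy_schwarz (R : realType) d (T : measurableType d)
    (mu : {measure set T -> \bar R}) (f g : T -> R) :
    mu.-integrable setT (EFin \o (fun w => f w * f w)) ->
    mu.-integrable setT (EFin \o (fun w => f w * g w)) ->
    mu.-integrable setT (EFin \o (fun w => g w * g w)) ->
  (\int[mu]_w (f w * g w)) ^+ 2 <=
  (\int[mu]_w (f w * f w)) * (\int[mu]_w (g w * g w)).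
Proof.
move=> iff ifg igg; apply: discriminant_le => t.
rewrite -RintegralZl// -RintegralZl// -RintegralB//; last exact: integrable_EFinZ.
rewrite -RintegralD//; first last.
- exact: integrable_EFinZ.
- by apply: integrable_EFinB => //; exact: integrable_EFinZ.
apply: Rintegral_ge0 => w _.
rewrite (_ : _ + _ = (f w - t * g w) ^+ 2) ?sqr_ge0//; by ring.
Qed.

(** * The kernel K_H, its quadratic form and the functions min(., u) *)

Section sub_fbm_kernel.
Context {R : realType}.
Local Notation mu := (@lebesgue_measure R).
Implicit Types (H s t u : R) (l : seq (R * R)).

Lemma sub_fbm_covC H s t : sub_fbm_cov H s t = sub_fbm_cov H t s.
Proof. by rewrite /sub_fbm_cov distrC [t + s]addrC [t `^ _ + _]addrC. Qed.

Lemma sub_fbm_covZ H m s t : 0 <= m -> 0 <= s -> 0 <= t ->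
  sub_fbm_cov H (m * s) (m * t) = m `^ (2 * H) * sub_fbm_cov H s t.
Proof.
move=> m0 s0 t0; rewrite /sub_fbm_cov -mulrDr -mulrBr normrM (ger0_norm m0).
rewrite !powRM ?addr_ge0 ?normr_ge0//; by ring.
Qed.

Lemma sub_fbm_cov_half s t : 0 <= s -> 0 <= t ->
  sub_fbm_cov 2^-1 s t = Num.min s t.
Proof.
move=> s0 t0; rewrite /sub_fbm_cov mulfV// !powRr1 ?addr_ge0//.
by have [st|ts] := leP s t; [rewrite ger0_norm ?subr_ge0//|rewrite ltr0_norm ?subr_lt0//]; field.
Qed.

Lemma sub_fbm_cov_diag_le H u : 0 <= u -> sub_fbm_cov H u u <= 2 * u `^ (2 * H).
Proof.
move=> u0; rewrite /sub_fbm_cov.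
by have := powR_ge0 (u + u) (2 * H); have := powR_ge0 `|u - u| (2 * H); lra.
Qed.

Lemma osc_weight H s t y : osc s y * osc t y * expR (- (2 * H * y)) =
  (osc s y * expR (- (2 * H * y)) + osc t y * expR (- (2 * H * y))) -
  2^-1 * (osc (s + t) y * expR (- (2 * H * y)) + osc (t - s) y * expR (- (2 * H * y))).
Proof. by rewrite oscM; ring. Qed.

Lemma integrable_oscM H s t : 0 < H -> H < 1 ->
  mu.-integrable setT (EFin \o (fun y => osc s y * osc t y * expR (- (2 * H * y)))).
Proof.
move=> H0 H1; rewrite (funext (osc_weight H s t)).
have h x : mu.-integrable setT (EFin \o (fun y => osc x y * expR (- (2 * H * y)))).
  by apply: (@integrable_osc _ x (2 * H)); lra.
apply: integrable_EFinB => //; first exact: integrable_EFinD.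
by apply: integrable_EFinZ => //; exact: integrable_EFinD.
Qed.

Lemma Rintegral_oscM H s t : 0 < H -> H < 1 -> 0 <= s -> 0 <= t ->
  \int[mu]_y (osc s y * osc t y * expR (- (2 * H * y))) =
  osc_moment (2 * H) * sub_fbm_cov H s t.
Proof.
move=> H0 H1 s0 t0; under eq_Rintegral do rewrite osc_weight.
have h x : mu.-integrable setT (EFin \o (fun y => osc x y * expR (- (2 * H * y)))).
  by apply: (@integrable_osc _ x (2 * H)); lra.
rewrite RintegralB//; [|exact: integrable_EFinD|]; last first.
  by apply: integrable_EFinZ => //; exact: integrable_EFinD.
rewrite RintegralZl//; last exact: integrable_EFinD.
rewrite !RintegralD// !Rintegral_osc; [|lra..].
rewrite (ger0_norm s0) (ger0_norm t0) (ger0_norm (addr_ge0 s0 t0)) /sub_fbm_cov; by ring.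
Qed.

(** The variance of the form [l] in $S_H$, written with the kernel alone. *)
Definition kvar H l := lin l (fun s => lin l (sub_fbm_cov H s)).

(** Up to the factor [osc_moment], sending a form [l] to the function [lin l (osc^~ y)] is an
    isometry from the inner product of K_H to that of L^2 with weight e^(-2Hy). *)
Lemma Rintegral_lin_oscM H l m : 0 < H -> H < 1 ->
    {in l, forall p, 0 <= p.2} -> {in m, forall p, 0 <= p.2} ->
  mu.-integrable setT (EFin \o (fun y =>
    lin l (osc^~ y) * lin m (osc^~ y) * expR (- (2 * H * y)))) /\
  \int[mu]_y (lin l (osc^~ y) * lin m (osc^~ y) * expR (- (2 * H * y))) =
  osc_moment (2 * H) * lin l (fun s => lin m (sub_fbm_cov H s)).
Proof.
move=> H0 H1 l0 m0.
have -> : (fun y => lin l (osc^~ y) * lin m (osc^~ y) * expR (- (2 * H * y))) =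
    (fun y => lin l (fun s => lin m (fun t => osc s y * osc t y * expR (- (2 * H * y))))).
  by apply/funext => y; rewrite linM -linZr; apply: eq_lin => p _; rewrite -linZr.
have i1 s : mu.-integrable setT (EFin \o (fun y =>
    lin m (fun t => osc s y * osc t y * expR (- (2 * H * y))))).
  by apply: integrable_lin => // p _; exact: integrable_oscM.
split; first by apply: integrable_lin => // p _; exact: i1.
rewrite Rintegral_lin//.
rewrite -linZ; apply: eq_lin => p /l0 p0; rewrite Rintegral_lin//; last first.
  by move=> q _; exact: integrable_oscM.
by rewrite -linZ; apply: eq_lin => q /m0 q0; rewrite Rintegral_oscM.
Qed.

Lemma kvar_ge0 H l : 0 < H -> H < 1 -> {in l, forall p, 0 <= p.2} -> 0 <= kvar H l.
Proof.
move=> H0 H1 l0; have [_] := Rintegral_lin_oscM H0 H1 l0 l0.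
have c0 : 0 < osc_moment (2 * H) by apply: osc_moment_gt0; lra.
rewrite -(pmulr_rge0 _ c0) => <-; apply: Rintegral_ge0 => y _.
by rewrite mulr_ge0 ?expR_ge0// -expr2 sqr_ge0.
Qed.

(* The kernel of index [2^-1] is [min], which therefore lies in the reproducing
   kernel Hilbert space of every index. *)
Lemma lin_min_le H : 0 < H -> H < 1 -> exists2 N : R, 0 < N &
  forall l u, {in l, forall p, 0 <= p.2} -> 0 <= u ->
  `|lin l (Num.min^~ u)| <= N * u `^ (1 - H) * Num.sqrt (kvar H l).
Proof.
move=> H0 H1.
have [c c0 cE] : exists2 c : R -> R,
    (forall p, 0 < p -> p < 2 -> 0 < c p) & osc_moment = c.
  by exists osc_moment => //; exact: osc_moment_gt0.
have half0 : 0 < 2^-1 :> R by lra.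
have half1 : 2^-1 < 1 :> R by lra.
have H'0 : 0 < 1 - H by lra.
have H'1 : 1 - H < 1 by lra.
have c1 : 0 < c 1 by apply: c0; lra.
have cH : 0 < c (2 * H) by apply: c0; lra.
have cH' : 0 < c (2 * (1 - H)) by apply: c0; lra.
(* Cauchy-Schwarz gives c(1)^2 L(min(., u))^2 <= c(2H) Var(L) c(2(1-H)) K_(1-H)(u, u), and
   K_(1-H)(u, u) <= 2 u^(2(1-H)). *)
exists (Num.sqrt (2 * c (2 * H) * c (2 * (1 - H))) / c 1).
  by rewrite divr_gt0// sqrtr_gt0 !mulr_gt0.
move=> l u l0 u0.
(* The weight of index 1/2 is split as e^(-y) = e^(-Hy) e^(-(1-H)y): the squares of the two factors
   are the weights of indices H and 1 - H, so all three integrals are instances of the isometry. *)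
pose f y := lin l (osc^~ y) * expR (- (H * y)).
pose g y := osc u y * expR (- ((1 - H) * y)).
have u1 : {in [:: (1, u)], forall p : R * R, 0 <= p.2}.
  by move=> p; rewrite inE => /eqP ->.
have lin1 (x : R -> R) : lin [:: (1, u)] x = x u.
  by rewrite lin_cons lin_nil addr0 mul1r.
have [iff eff] := Rintegral_lin_oscM H0 H1 l0 l0.
have [ifg efg] := Rintegral_lin_oscM half0 half1 l0 u1.
have [igg egg] := Rintegral_lin_oscM H'0 H'1 u1 u1.
have fE : (fun y => f y * f y) =
    (fun y => lin l (osc^~ y) * lin l (osc^~ y) * expR (- (2 * H * y))).
  by apply/funext => y; rewrite /f mulrACA -expRD; congr (_ * expR _); ring.
have fgE : (fun y => f y * g y) = (fun y => lin l (osc^~ y) *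
    lin [:: (1, u)] (osc^~ y) * expR (- (2 * 2^-1 * y))).
  by apply/funext => y; rewrite /f /g mulrACA -expRD lin1; congr (_ * expR _); field.
have gE : (fun y => g y * g y) = (fun y => lin [:: (1, u)] (osc^~ y) *
    lin [:: (1, u)] (osc^~ y) * expR (- (2 * (1 - H) * y))).
  by apply/funext => y; rewrite /g mulrACA -expRD lin1; congr (_ * expR _); ring.
have := @Rintegral_cauchy_schwarz _ _ _ mu f g; rewrite fE fgE gE.
move=> /(_ iff ifg igg); rewrite eff efg egg cE !lin1 mulfV//.
rewrite [X in (_ * X) ^+ 2](_ : _ = lin l (Num.min^~ u)); last first.
  by apply: eq_lin => p /l0 p0; rewrite lin1 sub_fbm_cov_half.
rewrite -/(kvar H l) => cs.
have v0 := kvar_ge0 H0 H1 l0.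
rewrite -(ler_pM2l c1) -{1}(gtr0_norm c1) -normrM.
set K := Num.sqrt _; rewrite (_ : c 1 * (K / _ * _ * _) =
  K * u `^ (1 - H) * Num.sqrt (kvar H l)); last by field; rewrite gt_eqF.
rewrite {}/K.
rewrite -ler_sqr ?nnegrE ?mulr_ge0 ?sqrtr_ge0 ?powR_ge0//.
rewrite real_normK ?num_real// (le_trans cs)// !exprMn.
rewrite (sqr_sqrtr v0) sqr_sqrtr ?mulr_ge0 ?(ltW cH) ?(ltW cH')//.
rewrite -powR_mulrn ?powR_ge0// -powRrM [(1 - H) * _]mulrC.
move: (kvar H l) (c (2 * H)) (c (2 * (1 - H))) (u `^ _) v0 cH cH'
  (sub_fbm_cov_diag_le (1 - H) u0) => v x y p v0' x0 y0 kp.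
rewrite (_ : 2 * x * y * p * v = x * v * (y * (2 * p))); last by ring.
by rewrite ler_wpM2l ?mulr_ge0 ?(ltW x0)// ler_wpM2l// ltW.
Qed.

End sub_fbm_kernel.

(** * Taylor expansion and time inversion *)

Section taylor.
Context {R : realType}.
Local Notation mu := (@lebesgue_measure R).

Lemma is_derive_lin (I : eqType) (m : seq (R * I)) (f : I -> R -> R) (df : I -> R) (x : R) :
    {in m, forall p, is_derive x 1 (f p.2) (df p.2)} ->
  is_derive x 1 (fun y => lin m (f^~ y)) (lin m df).
Proof.
elim: m => [_|p m IH h].
  rewrite lin_nil (_ : (fun y => _) = cst 0); first exact: is_derive_cst.
  by apply/funext => y; rewrite lin_nil.
rewrite (_ : (fun y => _) = (fun y => p.1 * f p.2 y + lin m (f^~ y))); last first.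
  by apply/funext => y; rewrite lin_cons.
rewrite lin_cons; apply: is_deriveD.
  by apply: is_deriveZ; apply: h; rewrite mem_head.
by apply: IH => q qm; apply: h; rewrite inE qm orbT.
Qed.

Variables (f f1 f2 : R -> R) (b : R).
Hypothesis b0 : 0 < b.
Hypothesis df : forall x : R, 0 <= x <= b -> is_derive x 1 f (f1 x).
Hypothesis df1 : forall x : R, 0 <= x <= b -> is_derive x 1 f1 (f2 x).
Hypothesis cf2 : forall x : R, 0 <= x <= b -> {for x, continuous f2}.
Hypotheses (f00 : f 0 = 0) (f10 : f1 0 = 0).

Let integrable_itv (g : R -> R) (a c : R) :
  {in `[a, c]%classic, continuous g} -> mu.-integrable `[a, c] (EFin \o g).
Proof.
move=> cg; apply: continuous_compact_integrable; first exact: segment_compact.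
exact: continuous_in_subspaceT.
Qed.

Let cmax (s v : R) : {for v, continuous (fun w : R => Num.max 0 (s - w))}.
Proof.
apply: (@continuous_max R _ (cst 0) (fun v : R => s - v)).
  exact: cvg_cst.
by apply: cvgB; [exact: cvg_cst|exact: cvg_id].
Qed.

Let cker (s v : R) : 0 <= v <= b -> {for v, continuous (fun w : R => Num.max 0 (s - w) * f2 w)}.
Proof. by move=> vb; apply: cvgM; [exact: cmax|exact: cf2]. Qed.

(** Taylor's formula with integral remainder. Since the hinge max(0, s - v) vanishes for v > s, the
    domain of integration does not depend on [s], and a linear form in [s] can pass under the
    integral. *)
Lemma taylor2 (s : R) : 0 <= s <= b ->
  f s = \int[mu]_(v in `[0, b]) (Num.max 0 (s - v) * f2 v).
Proof.
move=> /andP[s0 sb].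
have iker (c : R) : c <= b -> mu.-integrable `[0%R, c] (EFin \o (fun v : R => Num.max 0 (s - v) * f2 v)).
  move=> cb; apply: integrable_itv => v; rewrite inE/= in_itv/= => /andP[v0 vc].
  by apply: cker; rewrite v0 (le_trans vc).
have /esym/eqP := @Rintegral_itvB _ (fun v : R => Num.max 0 (s - v) * f2 v)
  (BLeft 0) (BRight b) s (iker b (lexx b)) s0 sb.
rewrite [X in X == _](_ : _ = 0); last first.
  rewrite /Rintegral integral0_eq// => v; rewrite /= in_itv/= => /andP[sv vb].
  by rewrite max_l ?mul0r// subr_le0 ltW.
rewrite eq_sym subr_eq0 => /eqP ->.
move: s0; rewrite le_eqVlt => /predU1P[<-|s0]; first by rewrite set_itv1 Rintegral_set1 f00.
(* An antiderivative of (s - v) f2(v), from integration by parts; its increment over [0, s] is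
   f(s). *)
pose F (v : R) := (s - v) * f1 v + f v.
have dF v : 0 <= v <= b -> is_derive v 1 F ((s - v) * f2 v).
  move=> vb; have := df vb; have := df1 vb => d1 d.
  by apply: is_derive_eq; rewrite /GRing.scale /=; ring.
have cF v : 0 <= v <= b -> {for v, continuous F}.
  by move=> vb; apply/differentiable_continuous/derivable1_diffP; exact: (@ex_derive _ _ _ _ _ _ _ (dF v vb)).
rewrite /Rintegral (@continuous_FTC2 _ _ F)//.
- by rewrite /F subrr mul0r add0r f10 mulr0 add0r f00 -EFinB subr0.
- apply: continuous_in_subspaceT => v; rewrite inE/= in_itv/= => /andP[v0 vs].
  by apply: cker; rewrite v0 (le_trans vs).
- split.
  + move=> v; rewrite in_itv/= => /andP[v0 vs].
    by apply: (@ex_derive _ _ _ _ _ _ _ (dF v _)); rewrite !ltW//= (lt_le_trans vs).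
  + by apply/cvg_at_right_filter/cF; rewrite lexx ltW.
  + by apply/cvg_at_left_filter/cF; rewrite sb ltW.
- move=> v; rewrite in_itv/= => /andP[v0 vs].
  have vb : 0 <= v <= b by rewrite !ltW//= (lt_le_trans vs).
  rewrite derive1E (@derive_val _ _ _ _ _ _ _ (dF v vb)) max_r// subr_ge0 ltW//.
Qed.

(** Under the integral the form acts on the hinges only, so a bound on hinges and a bound on the
    second derivative suffice. *)
Lemma lin_taylor2_le (l : seq (R * R)) (N B : R) :
    {in l, forall p, 0 <= p.2 <= b} ->
    (forall v : R, 0 <= v <= b -> `|lin l (fun s => Num.max 0 (s - v))| <= N) ->
    (forall v : R, 0 <= v <= b -> `|f2 v| <= B) ->
  `|lin l f| <= N * B * b.
Proof.
move=> lb hN hB.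
have ci (s : R) : mu.-integrable `[0%R, b] (EFin \o (fun v : R => Num.max 0 (s - v) * f2 v)).
  by apply: integrable_itv => v; rewrite inE/= in_itv/= => vb; exact: cker.
have -> : lin l f = \int[mu]_(v in `[0, b]) (lin l (fun s => Num.max 0 (s - v)) * f2 v).
  under eq_Rintegral do rewrite -linZr.
  by rewrite Rintegral_lin//; apply: eq_lin => p /lb pb; exact: taylor2.
have il : mu.-integrable `[0%R, b]
    (EFin \o (fun v => lin l (fun s => Num.max 0 (s - v)) * f2 v)).
  rewrite (_ : (fun v => _) = (fun v => lin l (fun s => Num.max 0 (s - v) * f2 v))).
    exact: integrable_lin.
  by apply/funext => v; rewrite linZr.
apply: (le_trans (le_normr_Rintegral _ il)) => //.
have mub : mu `[0, b]%classic = b%:E.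
  by rewrite lebesgue_measure_itv/= lte_fin b0 -EFinD subr0.
apply: (@le_trans _ _ (\int[mu]_(v in `[0, b]) (N * B))).
  apply: le_Rintegral => //.
  - exact: integrable_norm il.
  - apply: integrable_itv => v _; exact: cvg_cst.
  - move=> v; rewrite /= in_itv/= => vb; rewrite normrM.
    by apply: ler_pM; rewrite ?normr_ge0 ?hN ?hB.
by rewrite Rintegral_cst// [X in fine X]mub.
Qed.

End taylor.

(** * Decay of linear correlations *)

Section linear_correlation.
Context {R : realType}.
Implicit Types x : R.

(** Twice the even and the odd part of (1 + x)^p as a function of x. Differentiation exchanges them
    and lowers p by one. *)
Definition pow_even (p x : R) : R := (1 + x) `^ p + (1 - x) `^ p.
Definition pow_odd (p x : R) : R := (1 + x) `^ p - (1 - x) `^ p.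

Lemma is_derive_pow_even p x : -1 < x < 1 ->
  is_derive x 1 (pow_even p) (p * pow_odd (p - 1) x).
Proof.
move=> /andP[x0 x1].
have d1 : is_derive x 1 (fun y => (1 + y) `^ p) (p * (1 + x) `^ (p - 1)).
  have := @is_derive1_powR R p (1 + x) ltac:(lra) => d.
  have := @is_derive1_comp _ _ (fun y : R => 1 + y) x _ 1 d; rewrite mulr1; apply.
  by rewrite -[X in is_derive _ _ _ X]add0r; exact: (is_deriveD (is_derive_cst _ _ _) (is_derive_id _ _)).
have d2 : is_derive x 1 (fun y => (1 - y) `^ p) (- (p * (1 - x) `^ (p - 1))).
  have := @is_derive1_powR R p (1 - x) ltac:(lra) => d.
  have := @is_derive1_comp _ _ (fun y : R => 1 - y) x _ (-1) d; rewrite mulrN1; apply.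
  by rewrite -[X in is_derive _ _ _ X]sub0r; exact: (is_deriveB (is_derive_cst _ _ _) (is_derive_id _ _)).
by rewrite mulrBr; exact: is_deriveD.
Qed.

Lemma is_derive_pow_odd p x : -1 < x < 1 ->
  is_derive x 1 (pow_odd p) (p * pow_even (p - 1) x).
Proof.
move=> /andP[x0 x1].
have d1 : is_derive x 1 (fun y => (1 + y) `^ p) (p * (1 + x) `^ (p - 1)).
  have := @is_derive1_powR R p (1 + x) ltac:(lra) => d.
  have := @is_derive1_comp _ _ (fun y : R => 1 + y) x _ 1 d; rewrite mulr1; apply.
  by rewrite -[X in is_derive _ _ _ X]add0r; exact: (is_deriveD (is_derive_cst _ _ _) (is_derive_id _ _)).
have d2 : is_derive x 1 (fun y => (1 - y) `^ p) (- (p * (1 - x) `^ (p - 1))).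
  have := @is_derive1_powR R p (1 - x) ltac:(lra) => d.
  have := @is_derive1_comp _ _ (fun y : R => 1 - y) x _ (-1) d; rewrite mulrN1; apply.
  by rewrite -[X in is_derive _ _ _ X]sub0r; exact: (is_deriveB (is_derive_cst _ _ _) (is_derive_id _ _)).
by rewrite mulrDr -[p * (1 - x) `^ _]opprK; exact: is_deriveB.
Qed.

Lemma is_derive_scale (g : R -> R) (dg a x : R) :
  is_derive (x * a) 1 g dg -> is_derive x 1 (fun y => g (y * a)) (dg * a).
Proof.
move=> d; apply: (@is_derive1_comp _ g (fun y => y * a)).
by apply: is_derive_eq; rewrite /GRing.scale /= mulr0 add0r mulr1.
Qed.

(** On [1/2, 2], x^p is at most 2^p or (1/2)^p according to the sign of p; the sum covers both
    cases, the exponents becoming negative after differentiation. *)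
Definition pow_bound (p : R) : R := 2 `^ p + 2^-1 `^ p.

Lemma powR_le_bound p x : 2^-1 <= x <= 2 -> x `^ p <= pow_bound p.
Proof.
move=> /andP[x1 x2]; have x0 : 0 < x by lra.
have [p0|p0] := leP 0 p.
  by rewrite ler_wpDr ?powR_ge0// ge0_ler_powR ?nnegrE//; lra.
rewrite ler_wpDl ?powR_ge0//; have [q q0 ->] : exists2 q, 0 < q & p = - q.
  by exists (- p); rewrite ?oppr_gt0 ?opprK.
rewrite !powRN lef_pV2 ?posrE ?powR_gt0 ?invr_gt0//.
by rewrite ge0_ler_powR ?nnegrE ?invr_ge0 ?(ltW q0) ?(ltW x0)//.
Qed.

Lemma pow_even_le p x : 0 <= x <= 2^-1 -> `|pow_even p x| <= 2 * pow_bound p.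
Proof.
move=> /andP[x0 x1]; rewrite ger0_norm ?addr_ge0 ?powR_ge0//.
rewrite mulr_natl mulr2n; apply: lerD; apply: powR_le_bound; apply/andP; split; lra.
Qed.

Lemma pow_odd_le p x : 0 <= x <= 2^-1 -> `|pow_odd p x| <= 2 * pow_bound p.
Proof.
move=> x01; apply: le_trans (pow_even_le p x01); rewrite (le_trans (ler_normB _ _))//.
by rewrite !ger0_norm ?powR_ge0// addr_ge0 ?powR_ge0.
Qed.

(** For s <= b, the hinge max(0, s - v) is min(s, b) - min(s, v); each of the two terms contributes
    N b^(1-H). *)
Lemma lin_hinge_le (H N b v : R) (l : seq (R * R)) : 0 < H -> H < 1 -> 0 <= N ->
    (forall u, 0 <= u ->
      `|lin l (Num.min^~ u)| <= N * u `^ (1 - H) * Num.sqrt (kvar H l)) ->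
    {in l, forall p, 0 <= p.2 <= b} -> 0 <= v <= b ->
  `|lin l (fun s => Num.max 0 (s - v))| <=
  2 * N * b `^ (1 - H) * Num.sqrt (kvar H l).
Proof.
move=> H0 H1 N0 hN lb /andP[v0 vb]; have b0 := le_trans v0 vb.
rewrite (_ : lin l _ = lin l (Num.min^~ b) - lin l (Num.min^~ v)); last first.
  rewrite -linB; apply: eq_lin => p /lb/andP[_ pb]; rewrite (min_l pb).
  by have [pv|pv] := leP p.2 v; [rewrite max_l ?subrr|rewrite max_r]; lra.
rewrite (le_trans (ler_normB _ _))// (_ : 2 * N * _ * _ =
  N * b `^ (1 - H) * Num.sqrt (kvar H l) + N * b `^ (1 - H) * Num.sqrt (kvar H l)); last by ring.
apply: lerD; rewrite (le_trans (hN _ _))//.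
rewrite ler_wpM2r ?sqrtr_ge0// ler_wpM2l//.
by rewrite ge0_ler_powR ?nnegrE// subr_ge0 ltW.
Qed.

(** Replaces each S_H(t) by t^(2H) S_H(1/t), a process with the same covariance on positive times.
    Hence the variance is unchanged, and the bound on min(., u) also holds in the inverse times. *)
Definition time_inversion (H : R) (l : seq (R * R)) : seq (R * R) :=
  [seq (p.1 * p.2 `^ (2 * H), p.2^-1) | p <- l].

Lemma lin_inversion (H : R) l (x : R -> R) : lin (time_inversion H l) x =
  lin l (fun s => s `^ (2 * H) * x s^-1).
Proof. by rewrite /lin big_map; apply: eq_bigr => p _ /=; rewrite mulrA. Qed.

(** Homogeneity of degree 2H with factor st, which sends 1/s to t and 1/t to s; symmetry does the
    rest. *)
Lemma sub_fbm_cov_inversion (H s t : R) : 0 < s -> 0 < t ->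
  s `^ (2 * H) * t `^ (2 * H) * sub_fbm_cov H s^-1 t^-1 = sub_fbm_cov H s t.
Proof.
move=> s0 t0; rewrite -powRM ?ltW// -sub_fbm_covZ ?mulr_ge0 ?invr_ge0 ?ltW//.
rewrite [s * t * s^-1]mulrAC divff ?gt_eqF// mul1r mulfK ?gt_eqF//.
exact: sub_fbm_covC.
Qed.

Lemma kvar_inversion (H : R) (l : seq (R * R)) : {in l, forall p, 0 < p.2} ->
  kvar H (time_inversion H l) = kvar H l.
Proof.
move=> l0; rewrite /kvar lin_inversion; apply: eq_lin => p /l0 p0.
rewrite lin_inversion -linZ; apply: eq_lin => q /l0 q0.
by rewrite mulrA sub_fbm_cov_inversion.
Qed.

(** Here [t] is an inverse time: by homogeneity the left-hand side is K_H(st, 1). *)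
Lemma sub_fbm_cov_remainder (H s t : R) : 0 < t -> 0 <= s * t < 1 ->
  t `^ (2 * H) * sub_fbm_cov H s t^-1 =
  s `^ (2 * H) * t `^ (2 * H) + (1 - 2^-1 * pow_even (2 * H) (s * t)).
Proof.
move=> t0 /andP[st0 st1]; have s0 : 0 <= s by rewrite -(pmulr_lge0 _ t0).
rewrite -sub_fbm_covZ ?invr_ge0 ?(ltW t0)// divff ?gt_eqF// [t * s]mulrC.
rewrite /sub_fbm_cov powR1 powRM ?(ltW t0)// /pow_even [s * t + 1]addrC.
by rewrite ger0_norm ?subr_ge0 ?ltW//; ring.
Qed.

(* [tau^2 pow_even (2 H - 2) (s tau)] is, up to a constant, the second
   derivative in [s] of the remainder [1 - pow_even (2 H) (s tau) / 2]. *)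
Lemma lin_remainder_derivative_le (p : R) : exists2 Q : R, 0 <= Q &
  forall (b s N : R) (m : seq (R * R)), 0 < b -> b <= 2^-1 -> 0 <= s <= 1 ->
    {in m, forall q, 0 <= q.2 <= b} ->
    (forall v, 0 <= v <= b -> `|lin m (fun t => Num.max 0 (t - v))| <= N) ->
  `|lin m (fun t => t ^+ 2 * pow_even p (s * t))| <= N * Q * b.
Proof.
(* The three summands bound the three terms of [f2] below, using s <= 1 and t <= 1/2. *)
exists (2 * (2 * pow_bound p) + 2 * (`|p| * (2 * pow_bound (p - 1))) +
  `|p| * (`|p - 1| * (2 * pow_bound (p - 1 - 1)))).
  by rewrite !addr_ge0// !mulr_ge0// addr_ge0// ?powR_ge0.
move=> b s N m b0 b2 /andP[s0 s1] mb hN.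
have st t : 0 <= t <= b -> -1 < t * s < 1 by move=> /andP[t0 tb]; apply/andP; split; nra.
have st' t : 0 <= t <= b -> 0 <= t * s <= 2^-1 by move=> /andP[t0 tb]; apply/andP; split; nra.
pose E q t : R := pow_even q (t * s).
pose O q t : R := pow_odd q (t * s).
have dE q t : 0 <= t <= b -> is_derive t 1 (E q) (q * O (q - 1) t * s).
  by move=> /st tb; apply: is_derive_scale; exact: is_derive_pow_even.
have dO q t : 0 <= t <= b -> is_derive t 1 (O q) (q * E (q - 1) t * s).
  by move=> /st tb; apply: is_derive_scale; exact: is_derive_pow_odd.
pose f t := t ^+ 2 * E p t.
pose f1 t := 2 * t * E p t + t ^+ 2 * (p * O (p - 1) t * s).
pose f2 t := 2 * E p t + 4 * t * (p * O (p - 1) t * s) +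
  t ^+ 2 * (p * ((p - 1) * E (p - 1 - 1) t * s) * s).
have -> : lin m (fun t => t ^+ 2 * pow_even p (s * t)) = lin m f.
  by apply: eq_lin => q _; rewrite /f /E mulrC [s * _]mulrC [RHS]mulrC.
(* A second Taylor expansion, now in the inverse time; the factor t^2 makes the function and its
   first derivative vanish at 0. *)
apply: (@lin_taylor2_le _ f f1 f2) => //.
- move=> t /(dE p) dEt; apply: is_derive_eq; rewrite /f1 /GRing.scale /=; ring.
- move=> t tb; have dEt := dE p t tb; have dOt := dO (p - 1) t tb.
  apply: is_derive_eq; rewrite /f2 /GRing.scale /=; ring.
- move=> t tb; have dEt := dE p t tb; have dOt := dO (p - 1) t tb.
  have dE2t := dE (p - 1 - 1) t tb.
  apply/differentiable_continuous/derivable1_diffP.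
  exact: ex_derive.
- by rewrite /f expr0n mul0r.
- by rewrite /f1 mulr0 mul0r expr0n mul0r addr0.
- move=> t tb; have t0 : 0 <= t by case/andP: tb.
  have t2 : t <= 2^-1 by case/andP: tb => _ /le_trans; apply.
  have hE q : `|E q t| <= 2 * pow_bound q by apply/pow_even_le/st'.
  have hO q : `|O q t| <= 2 * pow_bound q by apply/pow_odd_le/st'.
  rewrite /f2 (le_trans (ler_normD _ _))// lerD//.
    rewrite (le_trans (ler_normD _ _))// lerD//.
      by rewrite normrM ger0_norm// ler_wpM2l.
    rewrite (_ : 4 * t * (p * O (p - 1) t * s) = 2 * (p * O (p - 1) t) * (2 * t * s)); last by ring.
    rewrite !normrM [`|2|]ger0_norm// (ger0_norm t0) (ger0_norm s0).
    rewrite -[leRHS]mulr1; apply: ler_pM; rewrite ?mulr_ge0//; last by nra.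
    by rewrite ler_wpM2l// ler_wpM2l.
  rewrite (_ : t ^+ 2 * _ = p * ((p - 1) * E (p - 1 - 1) t) * (t ^+ 2 * s ^+ 2)); last by ring.
  rewrite !normrM (ger0_norm t0) (ger0_norm s0).
  rewrite -[leRHS]mulr1; apply: ler_pM; rewrite ?mulr_ge0 ?sqr_ge0//.
    by rewrite ler_wpM2l// ler_wpM2l.
  by have /andP[a0 a1] := st' t tb; nra.
Qed.

End linear_correlation.

(** The assumption T >= 2 keeps x = s/t at most 1/2, away from the singularity at x = 1 of the
    derivatives of (1 - x)^(2H). The remainder is expanded in [s] first, which leaves [l] acting on
    hinges; its second derivative is a form [m'] in the inverse times, which the expansion in t
    reduces to hinges as well. *)
Lemma sub_fbm_linear_correlation {R : realType} (H : R) : 0 < H -> H < 1 ->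
  exists2 C : R, 0 < C & forall (T : R) (l m : seq (R * R)), 2 <= T ->
    {in l, forall p, 0 < p.2 <= 1} -> {in m, forall q, T <= q.2} ->
  `|lin l (fun s => lin m (sub_fbm_cov H s))| <=
  C * T `^ (- H) * (Num.sqrt (kvar H l) * Num.sqrt (kvar H m)).
Proof.
move=> H0 H1; have [N N0 hN] := lin_min_le H0 H1.
have [Q Q0 hQ] := @lin_remainder_derivative_le R (2 * H - 1 - 1).
(* The second derivative in s of 1 - [pow_even] (2H) (st) / 2 is -k t^2 [pow_even] (2H - 2) (st). *)
pose k : R := 2^-1 * (2 * H * (2 * H - 1)).
(* N^2 comes from the product term; in the remainder each of the two hinge bounds contributes 2N. *)
exists (N ^+ 2 + 4 * N ^+ 2 * `|k| * Q).
  by rewrite ltr_wpDr ?exprn_gt0// !mulr_ge0 ?(ltW N0)//.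
move=> T l m T2 l1 mT; have T0 : 0 < T by lra.
pose b := T^-1; have b0 : 0 < b by rewrite invr_gt0.
have b2 : b <= 2^-1 by rewrite lef_pV2 ?posrE.
have l0 : {in l, forall p, 0 < p.2} by move=> p /l1/andP[].
have m0 : {in m, forall p, 0 < p.2} by move=> p /mT; lra.
pose m' := time_inversion H m; pose l' := time_inversion H l.
have inv0 (w : seq (R * R)) : {in w, forall p, 0 < p.2} ->
    {in time_inversion H w, forall p, 0 <= p.2}.
  by move=> w0 _ /mapP[p /w0 p0 ->]; rewrite invr_ge0 ltW.
have m'b : {in m', forall q, 0 <= q.2 <= b}.
  move=> q qm'; rewrite (inv0 m)//=; case/mapP: qm' => p /mT pT -> /=.
  by rewrite lef_pV2 ?posrE//; lra.
have l01 : {in l, forall p, 0 <= p.2 <= 1} by move=> p /l1/andP[/ltW -> ->].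
have l00 : {in l, forall p, 0 <= p.2} by move=> p /l01/andP[].
have m00 : {in m, forall p, 0 <= p.2} by move=> p /m0/ltW.
set vl := Num.sqrt _; set vm := Num.sqrt _.
have vl0 : 0 <= vl by exact: sqrtr_ge0.
have vm0 : 0 <= vm by exact: sqrtr_ge0.
have hl (u : R) : 0 <= u -> `|lin l (Num.min^~ u)| <= N * u `^ (1 - H) * vl.
  exact: hN.
have hm (u : R) : 0 <= u -> `|lin m (Num.min^~ u)| <= N * u `^ (1 - H) * vm.
  exact: hN.
have hl' (u : R) : 0 <= u -> `|lin l' (Num.min^~ u)| <= N * u `^ (1 - H) * vl.
  by move=> u0; rewrite /vl -kvar_inversion//; apply: hN => //; exact: inv0.
have hm' (u : R) : 0 <= u -> `|lin m' (Num.min^~ u)| <= N * u `^ (1 - H) * vm.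
  by move=> u0; rewrite /vm -kvar_inversion//; apply: hN => //; exact: inv0.
pose f (s : R) : R := lin m' (fun t => 1 - 2^-1 * pow_even (2 * H) (s * t)).
have covE : lin l (fun s => lin m (sub_fbm_cov H s)) =
    lin l (fun s => s `^ (2 * H)) * lin m' (fun t => t `^ (2 * H)) + lin l f.
  rewrite linM -linD; apply: eq_lin => p /l1/andP[p0 p1].
  rewrite /f -linD lin_inversion; apply: eq_lin => q qm; have q0 := m0 _ qm.
  rewrite -sub_fbm_cov_remainder ?invr_gt0//; last first.
    rewrite mulr_ge0 ?invr_ge0 ?ltW//= ltr_pdivrMr// mul1r.
    by have := mT _ qm; lra.
  rewrite invrK mulrA -powRM ?invr_ge0 ?ltW// divff ?gt_eqF//.
  by rewrite powR1 mul1r.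
(* For s <= 1, min(1/s, 1) = 1, so s^(2H) is the time inversion of min(., 1). *)
have term1l : `|lin l (fun s => s `^ (2 * H))| <= N * vl.
  have := hl' 1 ler01; rewrite powR1 mulr1; apply: le_trans.
  rewrite lin_inversion le_eqVlt; apply/orP; left; apply/eqP; congr Num.norm.
  by apply: eq_lin => p /l1/andP[p0 p1]; rewrite min_r ?mulr1// invf_ge1.
(* In the original times the powers cancel, and for q >= T the remaining constant 1 equals T^(-1)
   min(q, T). *)
have term1m : `|lin m' (fun t => t `^ (2 * H))| <= N * T `^ (- H) * vm.
  have -> : lin m' (fun t => t `^ (2 * H)) = T^-1 * lin m (Num.min^~ T).
    rewrite lin_inversion -linZ; apply: eq_lin => p pm; have p0 := m0 _ pm.
    rewrite min_r ?mT// mulVf ?gt_eqF// -powRM ?invr_ge0 ?ltW//.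
    by rewrite divff ?gt_eqF// powR1.
  have Ti : 0 <= T^-1 by rewrite invr_ge0 ltW.
  rewrite normrM (ger0_norm Ti); apply: (le_trans (ler_wpM2l Ti (hm _ (ltW T0)))).
  rewrite powRD; last by rewrite (gt_eqF T0) implybT.
  rewrite (powRr1 (ltW T0)) le_eqVlt; apply/orP; left; apply/eqP.
  by field; rewrite gt_eqF.
have hinge_m (v : R) : 0 <= v <= b ->
    `|lin m' (fun t => Num.max 0 (t - v))| <= 2 * N * b `^ (1 - H) * vm.
  have := @lin_hinge_le _ H N b v m' H0 H1 (ltW N0).
  by rewrite kvar_inversion// => h vb; exact: h.
have hinge_l (v : R) : 0 <= v <= 1 ->
    `|lin l (fun t => Num.max 0 (t - v))| <= 2 * N * vl.
  have := @lin_hinge_le _ H N 1 v l H0 H1 (ltW N0).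
  by rewrite powR1 mulr1 => h vb; exact: h.
pose f1 (s : R) : R := lin m' (fun t : R => - (2^-1 * (2 * H * pow_odd (2 * H - 1) (s * t) * t))).
pose f2 (s : R) : R := lin m' (fun t : R => - (k * (t ^+ 2 * pow_even (2 * H - 1 - 1) (s * t)))).
have st (s t : R) : 0 <= s <= 1 -> 0 <= t <= b -> -1 < s * t < 1.
  by move=> /andP[s0 s1] /andP[t0 tb]; apply/andP; split; nra.
have df (s : R) : 0 <= s <= 1 -> is_derive s 1 f (f1 s).
  move=> s01; apply: is_derive_lin => q /m'b qb.
  have dE := is_derive_scale (is_derive_pow_even (2 * H) (st _ _ s01 qb)).
  rewrite -[X in is_derive _ _ _ X]sub0r.
  by apply: is_deriveB; apply: is_deriveZ.
have df1 (s : R) : 0 <= s <= 1 -> is_derive s 1 f1 (f2 s).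
  move=> s01; apply: is_derive_lin => q /m'b qb.
  have dO := is_derive_scale (is_derive_pow_odd (2 * H - 1) (st _ _ s01 qb)).
  apply: is_derive_eq; rewrite /k /GRing.scale /=; ring.
have cf2 (s : R) : 0 <= s <= 1 -> {for s, continuous f2}.
  move=> s01; apply/differentiable_continuous/derivable1_diffP.
  suff [df2 d] : exists d, is_derive s 1 f2 d by exact: ex_derive.
  exists (lin m' (fun t => - (k * (t ^+ 2 *
    ((2 * H - 1 - 1) * pow_odd (2 * H - 1 - 1 - 1) (s * t) * t))))).
  apply: is_derive_lin => q /m'b qb.
  have dE := is_derive_scale (is_derive_pow_even (2 * H - 1 - 1) (st _ _ s01 qb)).
  by apply: is_deriveN; apply: is_deriveZ; apply: is_deriveZ; exact: dE.
have f00 : f 0 = 0.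
  rewrite /f (_ : (fun t => _) = (fun t => 0 * 1)) ?linZ ?mul0r//.
  apply/funext => t; rewrite !mul0r /pow_even subr0 addr0 !powR1; lra.
have f10 : f1 0 = 0.
  rewrite /f1 (_ : (fun t => _) = (fun t => 0 * 1)) ?linZ ?mul0r//.
  apply/funext => t; rewrite !mul0r /pow_odd subr0 addr0 !powR1 subrr; ring.
have hf2 (s : R) : 0 <= s <= 1 ->
    `|f2 s| <= `|k| * (2 * N * b `^ (1 - H) * vm * Q * b).
  move=> s01; rewrite /f2 linN normrN linZ normrM ler_wpM2l//.
  exact: hQ.
have := lin_taylor2_le ltr01 df df1 cf2 f00 f10 l01 hinge_l hf2.
rewrite mulr1 => term2; rewrite covE (le_trans (ler_normD _ _))// normrM.
rewrite [(N ^+ 2 + _) * _]mulrDl [(_ + _) * (vl * vm)]mulrDl; apply: lerD.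
  rewrite (_ : N ^+ 2 * _ * _ = N * vl * (N * T `^ (- H) * vm)); last by ring.
  exact: ler_pM.
apply: (le_trans term2).
(* The left-hand side is b^(2-H), with b <= 1 and 2 - H >= H. *)
have bT : b `^ (1 - H) * b <= T `^ (- H).
  rewrite -{2}[b]powRr1 ?(ltW b0)// -powRD; last by rewrite (gt_eqF b0) implybT.
  rewrite [leRHS](_ : _ = b `^ H); last first.
    by rewrite /b -powR_inv1 ?(ltW T0)// -powRrM mulN1r.
  by apply: ger_powR; [rewrite b0; lra|lra].
rewrite (_ : 2 * N * vl * _ =
  4 * N ^+ 2 * `|k| * Q * (vl * vm) * (b `^ (1 - H) * b)); last by ring.
rewrite (_ : 4 * N ^+ 2 * `|k| * Q * T `^ (- H) * (vl * vm) =
  4 * N ^+ 2 * `|k| * Q * (vl * vm) * T `^ (- H)); last by ring.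
by rewrite ler_wpM2l// !mulr_ge0 ?(ltW N0)//.
Qed.

(** * Characteristic function of a Gaussian variable *)

Section normal_integral.
Context {R : realType}.
Local Notation mu := (@lebesgue_measure R).
Variables m s : R.

Lemma integral_normal_prob (f : R -> \bar R) :
    (normal_prob m s).-integrable setT f ->
  (\int[normal_prob m s]_x f x = \int[mu]_x (f x * (normal_pdf m s x)%:E))%E.
Proof.
move=> intf; have dom := @normal_prob_dominates R m s.
rewrite -(Radon_Nikodym_change_of_variables dom)//.
have mf := measurable_int _ intf.
apply: ae_eq_integral => //.
- apply: emeasurable_funM => //; apply: (measurable_int mu).
- apply: emeasurable_funM => //; apply/measurable_EFinP.
  exact: measurable_normal_pdf.
- apply: ae_eqe_mul2l; rewrite Radon_NikodymE; case: cid => /= h [_ ih hE].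
  apply: integral_ae_eq => //.
    by apply/measurable_EFinP; exact: measurable_normal_pdf.
  by move=> E _ mE; rewrite -hE.
Qed.

Lemma integrable_normal_prob (f : R -> \bar R) :
    (normal_prob m s).-integrable setT f ->
  mu.-integrable setT (fun x => f x * (normal_pdf m s x)%:E)%E.
Proof.
move=> intf; have mf := measurable_int _ intf.
have intaf : (normal_prob m s).-integrable setT (abse \o f) by exact: integrable_abse.
apply/integrableP; split.
  apply: emeasurable_funM => //; apply/measurable_EFinP.
  exact: measurable_normal_pdf.
have <- : (\int[normal_prob m s]_x `|f x| =
    \int[mu]_x `|f x * (normal_pdf m s x)%:E|)%E; last by case/integrableP: intf.
rewrite integral_normal_prob//; apply: eq_integral => x _.
by rewrite abseM (@gee0_abs _ (normal_pdf m s x)%:E)// lee_fin normal_pdf_ge0.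
Qed.

End normal_integral.

Section integral_derivative.
Context {R : realType}.
Local Notation mu := (@lebesgue_measure R).

Lemma Rintegral_derivative_eq0 (F f : R -> R) :
    (forall x : R, is_derive x 1 F (f x)) -> continuous f ->
    mu.-integrable setT (EFin \o f) ->
    F n%:R @[n --> \oo] --> 0 -> F (- n%:R) @[n --> \oo] --> 0 ->
  \int[mu]_x f x = 0.
Proof.
move=> dF cf intf Fy FNy.
have mf : measurable_fun setT f by exact: continuous_measurable_fun.
have cF : continuous F.
  by move=> x; apply/differentiable_continuous/derivable1_diffP; exact: (@ex_derive _ _ _ _ _ _ _ (dF x)).
(* The half-width n + 1 keeps every interval nondegenerate, as the fundamental theorem of calculus
   requires. *)
pose A n : set R := `[- n.+1%:R, n.+1%:R]%classic.
have mA n : measurable (A n) by exact: measurable_itv.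
have FA n : (\int[mu]_(x in A n) (f x)%:E = (F n.+1%:R - F (- n.+1%:R))%:E)%E.
  rewrite /A (@continuous_FTC2 _ f F) ?EFinB//.
  - by rewrite -subr_gt0 opprK addr_gt0.
  - exact: continuous_subspaceT.
  - split.
    + by move=> x _; exact: (@ex_derive _ _ _ _ _ _ _ (dF x)).
    + exact/cvg_at_right_filter/cF.
    + exact/cvg_at_left_filter/cF.
  - by move=> x _; rewrite derive1E (@derive_val _ _ _ _ _ _ _ (dF x)).
have [] := @dominated_convergence _ _ _ mu setT measurableT
  (fun n => (EFin \o f) \_ (A n)) (EFin \o f) (abse \o (EFin \o f)).
- move=> n; apply: (measurable_restrictT _ (mA n)).1.
  by apply/measurable_EFinP; exact: measurable_funTS.
- exact/measurable_EFinP.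
- apply: aeW => x _; apply: cvg_near_cst; near=> n.
  rewrite patchE ifT// inE /A/= in_itv/= -ler_norml.
  apply: (@le_trans _ _ n%:R); last by rewrite ler_nat.
  by near: n; exact: nbhs_infty_ger.
- exact: integrable_abse.
- apply: aeW => x n _; rewrite patchE; case: ifP => // _.
  by rewrite abse0 abse_ge0.
move=> _ _; rewrite (_ : [sequence _]_n = (fun n => (F n.+1%:R - F (- n.+1%:R))%:E)); last first.
  by apply/funext => n; rewrite -FA integral_mkcond.
rewrite -(fineK (integrable_fin_num measurableT intf)) => /fine_cvg h.
have h0 : F n.+1%:R - F (- n.+1%:R) @[n --> \oo] --> 0 - 0.
  apply: cvgB.
    by move: Fy; rewrite -cvg_shiftS.
  by move: FNy; rewrite -cvg_shiftS.
by rewrite subr0 in h0; exact: (cvg_unique _ h h0).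
Unshelve. all: by end_near. Qed.

End integral_derivative.

Section stein.
Context {R : realType}.
Local Notation mu := (@lebesgue_measure R).
Variables m s : R.
Hypothesis s0 : 0 < s.
Let phi := normal_pdf m s.

Let phiE x : phi x = normal_peak s * normal_fun m s x.
Proof. by rewrite /phi normal_pdfE ?gt_eqF. Qed.

Lemma is_derive_normal_pdf (x : R) :
  is_derive x 1 phi (- ((x - m) / s ^+ 2) * phi x).
Proof.
have sn0 : s != 0 by rewrite gt_eqF.
pose q (y : R) := - (2 * s ^+ 2)^-1 * (y - m) ^+ 2.
have fE y : normal_fun m s y = expR (q y).
  by rewrite /normal_fun /q; congr expR; field.
have dq : is_derive x 1 q (- ((x - m) / s ^+ 2)).
  by apply: is_derive_eq; rewrite /GRing.scale /=; field.
have dexp := @is_derive1_comp _ expR q x _ _ (is_derive_expR (q x)) dq.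
rewrite [X in is_derive _ _ X _](_ : _ = (fun y => normal_peak s * expR (q y))).
  rewrite phiE fE (_ : _ * (_ * _) = normal_peak s * (expR (q x) * - ((x - m) / s ^+ 2))).
    exact: is_deriveZ.
  by ring.
by apply/funext => y; rewrite phiE fE.
Qed.

(** With u = |x - m| and v = u^2 / (2s^2), one has (1 + u)^2 <= 2(1 + u^2) and e^v >= 1 + v.
    Quadratic decay is enough to kill boundary terms of linear growth. *)
Lemma normal_pdf_decay (x : R) : (1 + `|x - m|) ^+ 2 * phi x <=
  2 * (1 + 2 * s ^+ 2) * normal_peak s.
Proof.
rewrite phiE mulrCA [leRHS]mulrC ler_wpM2l ?normal_peak_ge0// /normal_fun.
set v := (x - m) ^+ 2 / (s ^+ 2 *+ 2).
have v0 : 0 <= v by rewrite divr_ge0 ?mulrn_wge0 ?sqr_ge0.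
have uv : `|x - m| ^+ 2 = 2 * s ^+ 2 * v.
  by rewrite real_normK ?num_real// /v; field; rewrite gt_eqF.
rewrite mulNr -/v expRN ler_pdivrMr ?expR_gt0//.
have := expR_ge1Dx v; move: (`|x - m|) uv (expR v) => u uv e ev.
have := sqr_ge0 (1 - u); have := sqr_ge0 s; nra.
Qed.

(** Gaussian integration by parts: the derivative of g phi is g' phi - s^(-2) (x - m) g phi, and its
    integral over the line is 0. *)
Lemma stein (g dg : R -> R) (c : R) :
    (forall x : R, is_derive x 1 g (dg x)) -> continuous dg ->
    (forall x, `|g x| <= c * (1 + `|x - m|)) ->
    mu.-integrable setT (EFin \o (fun x => dg x * phi x)) ->
    mu.-integrable setT (EFin \o (fun x => (x - m) * g x * phi x)) ->
  \int[mu]_x ((x - m) * g x * phi x) = s ^+ 2 * \int[mu]_x (dg x * phi x).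
Proof.
move=> dgE cdg gc idg ig; pose F x := g x * phi x.
pose f x := dg x * phi x - s ^- 2 * ((x - m) * g x * phi x).
have dF (x : R) : is_derive x 1 F (f x).
  have dg' := dgE x; have dphi := is_derive_normal_pdf x.
  by apply: is_derive_eq; rewrite /f /GRing.scale /=; ring.
have cphi : continuous phi by apply: continuous_normal_pdf; rewrite gt_eqF.
have cg : continuous g.
  by move=> x; apply/differentiable_continuous/derivable1_diffP; exact: (@ex_derive _ _ _ _ _ _ _ (dgE x)).
have cf : continuous f.
  move=> x; apply: cvgB; first by apply: cvgM; [exact: cdg|exact: cphi].
  apply: cvgM; first exact: cvg_cst.
  apply: cvgM; last exact: cphi.
  by apply: cvgM; [apply: cvgB; [exact: cvg_id|exact: cvg_cst]|exact: cg].
have c0 : 0 <= c.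
  by have := le_trans (normr_ge0 _) (gc m); rewrite subrr normr0 addr0 mulr1.
pose K := c * (2 * (1 + 2 * s ^+ 2) * normal_peak s).
have K0 : 0 <= K by rewrite !mulr_ge0 ?normal_peak_ge0// addr_ge0// mulr_ge0 ?sqr_ge0.
have FK x : `|F x| * (1 + `|x - m|) <= K.
  rewrite /F normrM [`|phi x|]ger0_norm ?normal_pdf_ge0//.
  apply: (le_trans _ (ler_wpM2l c0 (normal_pdf_decay x))).
  rewrite (_ : c * _ = c * (1 + `|x - m|) * phi x * (1 + `|x - m|)); last by ring.
  by rewrite !ler_wpM2r ?addr_ge0 ?normal_pdf_ge0.
have F0 (x : nat -> R) : (forall n, `|x n| = n%:R) -> F (x n) @[n --> \oo] --> 0.
  move=> xn; apply/cvgrPdist_le => e e0; near=> n; rewrite sub0r normrN.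
  have n1 : K / e + `|m| <= n%:R by near: n; exact: nbhs_infty_ger.
  have h := FK (x n); have := lerB_dist (x n) m; rewrite xn => h'.
  have h2 : K <= e * (1 + `|x n - m|).
    by rewrite -ler_pdivrMl// mulrC; lra.
  have p0 : 0 < 1 + `|x n - m| by rewrite ltr_wpDr.
  by rewrite -(ler_pM2r p0) (le_trans h).
have ig' := integrable_EFinZ measurableT (s ^- 2) ig.
have F1 : F n%:R @[n --> \oo] --> 0 by apply: F0 => n; rewrite ger0_norm.
have F2 : F (- n%:R) @[n --> \oo] --> 0.
  by apply: F0 => n; rewrite normrN ger0_norm.
have := Rintegral_derivative_eq0 dF cf (integrable_EFinB measurableT idg ig') F1 F2.
rewrite /f RintegralB// RintegralZl// => /eqP; rewrite subr_eq0 => /eqP ->.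
by rewrite mulrA divff ?mul1r// sqrf_eq0 gt_eqF.
Unshelve. all: by end_near. Qed.

End stein.

(** A quadratic error bound survives integration, so this gives differentiation under the
    expectation as soon as the second moment is finite. *)
Lemma is_derive_quadratic {R : realType} (f : R -> R) (x d M : R) :
  (forall h, `|f (x + h) - f x - h * d| <= M * h ^+ 2) -> is_derive x 1 f d.
Proof.
move=> fM.
have M0 : 0 <= M by have := le_trans (normr_ge0 _) (fM 1); rewrite expr1n mulr1.
suff fd : h^-1 *: ((f \o shift x) (h *: 1) - f x) @[h --> 0^'] --> d.
  by apply: DeriveDef; [apply/cvg_ex; exists d|exact: cvg_lim].
apply/cvgrPdist_le => e e0; near=> h.
have h0 : h != 0 by near: h; exact: nbhs_dnbhs_neq.
have hM : M * `|h| <= e.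
  have h1 : `|h| <= e / (M + 1).
    by near: h; apply: dnbhs0_le; rewrite divr_gt0// ltr_wpDl.
  rewrite (le_trans (ler_wpM2l M0 h1))// mulrCA ler_piMr ?(ltW e0)//.
  by rewrite ler_pdivrMr ?mul1r ?lerDl// ltr_wpDl.
rewrite /GRing.scale /= mulr1 [h + x]addrC.
have nh : 0 < `|h| by rewrite normr_gt0.
rewrite -(ler_pM2l nh) -normrM mulrBr mulVKf// distrC.
apply: (le_trans (fM h)); rewrite -real_normK ?num_real// expr2 mulrA mulrC.
by rewrite ler_wpM2l.
Unshelve. all: by end_near. Qed.

Lemma cosD_quadratic {R : realType} (x h : R) :
  `|cos (x + h) - cos x + h * sin x| <= 2 * h ^+ 2.
Proof.
have cos1 (c : R) : 1 - cos c <= `|c|.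
  rewrite (_ : c = (c / 2) *+ 2); last by rewrite -mulr_natr divfK.
  rewrite cos_mulr2n cos2sin2 normrMn; have := sin_le_norm (c / 2).
  have := sin_max (c / 2); have := normr_ge0 (sin (c / 2)).
  rewrite -(@real_normK _ (sin (c / 2))) ?num_real//.
  move: (`|c / 2|) (`|sin (c / 2)|) => a u; rewrite !mulr2n; nra.
have sinh : `|h - sin h| <= h ^+ 2.
  wlog h0 : h / 0 <= h => [H|].
    have [|/ltW h0] := leP 0 h; first exact: H.
    by rewrite -sqrrN -normrN opprD -sinN H// oppr_ge0.
  have [|c] := @MVT_segment R (fun y => y - sin y) (fun y => 1 - cos y) 0 h h0.
    apply: continuous_subspaceT => y; apply: cvgB; first exact: cvg_id.
    exact: continuous_sin.
  rewrite in_itv/= => /andP[c0 ch]; rewrite sin0 !subr0 => ->.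
  rewrite normrM !ger0_norm ?subr_ge0 ?cos_le1// expr2 ler_wpM2r//.
  by rewrite (le_trans (cos1 c))// ger0_norm.
rewrite cosD (_ : _ + _ = - (cos x * (1 - cos h)) + sin x * (h - sin h)); last by ring.
rewrite (le_trans (ler_normD _ _))// mulr_natl mulr2n; apply: lerD.
  rewrite normrN normrM (@le_trans _ _ (1 * (1 - cos h)))//.
    rewrite ler_pM ?cos_max// ger0_norm// subr_ge0 cos_le1.
  by rewrite mul1r onem_cos_le_sqr.
by rewrite normrM -[leRHS]mul1r ler_pM ?sin_max.
Qed.

Lemma bounded_integrable {R : realType} d (T : measurableType d)
    (P : probability T R) (f : T -> R) (M : R) :
    measurable_fun setT f -> (forall w, `|f w| <= M) ->
  P.-integrable setT (EFin \o f).
Proof.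
move=> mf fM; apply: (@integrable_EFin_le _ _ _ P _ measurableT _ (cst M)) => //.
exact: finite_measure_integrable_cst.
Qed.

Section gaussian_cos.
Context {R : realType} d {T : measurableType d} (P : probability T R).
Variable Z : {RV P >-> R}.
Let mZ : measurable_fun setT Z := measurable_funPT Z.
Hypothesis iZZ : P.-integrable setT (EFin \o (fun w => Z w * Z w)).

Lemma integrable_of_square : P.-integrable setT (EFin \o Z).
Proof.
apply: (@integrable_EFin_le _ _ _ P _ measurableT _ (fun w => 1 + Z w * Z w)) => //.
  by move=> w _; have [z0|z0] := ger0P (Z w); nra.
apply: integrable_EFinD => //; exact: finite_measure_integrable_cst.
Qed.

Let Z' : {mfun T >-> measurableTypeR R} :=
  @mfun_Sub _ _ T (measurableTypeR R) Z (mem_set mZ).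

Let transfer (nu : probability (measurableTypeR R) R) (h : measurableTypeR R -> R) :
    (forall B : set R, measurable B -> pushforward P Z B = nu B) ->
    measurable_fun setT h -> P.-integrable setT (EFin \o (h \o Z)) ->
  nu.-integrable setT (EFin \o h) /\ \int[P]_w h (Z w) = \int[nu]_x h x.
Proof.
move=> PZ mh ih; have mh' : measurable_fun setT (EFin \o h) by exact/measurable_EFinP.
have mZ' : measurable_fun setT Z' by exact: measurable_funPT.
have E (f : measurableTypeR R -> \bar R) :
    (\int[distribution P Z']_x f x = \int[nu]_x f x)%E.
  by apply: eq_measure_integral => A mA _; exact: PZ.
split; last by rewrite /Rintegral -E (integral_pushforward mZ').
apply/integrableP; split => //; rewrite -E.
have := integrable_pushforward mZ' mh' ih measurableT.
by case/integrableP.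
Qed.

(** In the nondegenerate case G(t) = E cos(tZ + b) satisfies G'(t) = -s^2 t G(t) by Stein's
    identity, so G(t) e^(s^2 t^2 / 2) is constant; its values at 0 and 1 are compared. The phase [b]
    covers the real and imaginary parts of the characteristic function together. *)
Lemma gaussian_cos : gaussian_law (pushforward P Z) -> \int[P]_w Z w = 0 ->
  forall b, \int[P]_w cos (Z w + b) =
    cos b * expR (- (2^-1 * \int[P]_w (Z w * Z w))).
Proof.
move=> law EZ b; move: law EZ; have iZ := integrable_of_square.
have mcos : measurable_fun setT (@cos R).
  by apply: continuous_measurable_fun; exact: continuous_cos.
have msin : measurable_fun setT (@sin R).
  by apply: continuous_measurable_fun; exact: continuous_sin.
have mtb (t c : R) : measurable_fun setT (fun x : R => t * x + c).
  by apply: measurable_funD => //; apply: measurable_funM.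
have mDb : measurable_fun setT (fun x : R => x + b).
  have := mtb 1 b; rewrite (_ : (fun x : R => 1 * x + b) = (fun x => x + b))//.
  by apply/funext => x; rewrite mul1r.
case=> [[m PZ]|[m [s [s0 PZ]]]] EZ.
  have tr h : measurable_fun setT h -> P.-integrable setT (EFin \o (h \o Z)) ->
      \int[P]_w h (Z w) = h m.
    move=> mh ih; have [_ ->] := transfer (nu := \d_(m : measurableTypeR R)) PZ mh ih.
    by rewrite /Rintegral integral_dirac ?diracT ?mul1e//; exact/measurable_EFinP.
  have m0 : m = 0 by rewrite -EZ (tr id).
  have -> : \int[P]_w (Z w * Z w) = 0.
    by rewrite (tr (fun x => x * x)) ?m0 ?mul0r//; exact: measurable_funM.
  rewrite mulr0 oppr0 expR0 mulr1 (tr (fun x => cos (x + b))) ?m0 ?add0r//.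
    exact: (measurableT_comp mcos mDb).
  apply: (@bounded_integrable _ _ _ P _ 1) => [|w]; last exact: cos_max.
  exact: (measurableT_comp mcos (measurableT_comp mDb mZ)).
have tr h : measurable_fun setT h -> P.-integrable setT (EFin \o (h \o Z)) ->
    lebesgue_measure.-integrable setT (EFin \o (fun x => h x * normal_pdf m s x)) /\
    \int[P]_w h (Z w) = \int[lebesgue_measure]_x (h x * normal_pdf m s x).
  move=> mh ih; have [ih' ->] := transfer (nu := normal_prob m s) PZ mh ih.
  split; first exact: (integrable_normal_prob ih').
  by rewrite /Rintegral (integral_normal_prob ih').
have icst c : P.-integrable setT (EFin \o (fun=> c : R)).
  exact: finite_measure_integrable_cst.
have iZm : P.-integrable setT (EFin \o (fun w => Z w - m)) by exact: integrable_EFinB.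
have iZmm : P.-integrable setT (EFin \o (fun w => (Z w - m) * (Z w - m))).
  rewrite (_ : (fun w => _) = (fun w => Z w * Z w + (- (2 * m) * Z w + m ^+ 2))).
    by do 2 (apply: integrable_EFinD => //); exact: integrable_EFinZ.
  by apply/funext => w; ring.
have steinP (g dg : R -> R) (c : R) : (forall x : R, is_derive x 1 g (dg x)) ->
    continuous dg -> (forall x, `|g x| <= c * (1 + `|x - m|)) ->
    P.-integrable setT (EFin \o (dg \o Z)) ->
    P.-integrable setT (EFin \o (fun w => (Z w - m) * g (Z w))) ->
  \int[P]_w ((Z w - m) * g (Z w)) = s ^+ 2 * \int[P]_w dg (Z w).
  move=> dgE cdg gc idg ig.
  have mg : measurable_fun setT g.
    apply: continuous_measurable_fun => x; apply/differentiable_continuous/derivable1_diffP.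
    exact: (@ex_derive _ _ _ _ _ _ _ (dgE x)).
  have mxg : measurable_fun setT (fun x : R => (x - m) * g x).
    by apply: measurable_funM => //; exact: measurable_funB.
  have [i1 ->] := tr dg (continuous_measurable_fun cdg) idg.
  have [i2 ->] := tr _ mxg ig.
  exact: (@stein _ m s s0 g dg c).
(* Stein's identity with g = 1 identifies the mean, and below with g = id the variance. *)
have m0 : m = 0.
  have := @steinP (fun=> 1) (fun=> 0) 1 (fun x => is_derive_cst _ _ _) (fun x => cvg_cst _) _ (icst 0).
  under eq_Rintegral do rewrite mulr1.
  rewrite RintegralB// EZ !Rintegral_cst// [X in fine X]probability_setT !mulr1 mulr0 sub0r.
  move=> h; apply/eqP; rewrite -oppr_eq0; apply/eqP/h.
    by move=> x; rewrite normr1 mul1r lerDl.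
  by under [X in EFin \o X]eq_fun do rewrite mulr1.
subst m.
have ZZ : \int[P]_w (Z w * Z w) = s ^+ 2.
  have := @steinP id (fun=> 1) 1 (fun x => is_derive_id _ _) (fun x => cvg_cst _) _ (icst 1).
  rewrite Rintegral_cst// [X in fine X]probability_setT !mulr1.
  under eq_Rintegral do rewrite subr0.
  apply; first by move=> x; rewrite mul1r subr0 lerDr.
  by under [X in EFin \o X]eq_fun do rewrite subr0.
pose G (t : R) := \int[P]_w cos (t * Z w + b).
have icos (t : R) : P.-integrable setT (EFin \o (fun w => cos (t * Z w + b))).
  apply: (@bounded_integrable _ _ _ P _ 1) => [|w]; last exact: cos_max.
  apply: (measurableT_comp mcos); exact: (measurableT_comp (mtb t b) mZ).
have isin (t : R) : P.-integrable setT (EFin \o (fun w => Z w * sin (t * Z w + b))).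
  apply: (@integrable_EFin_le _ _ _ P _ measurableT _ (fun w => `|Z w|)).
  - apply: measurable_funM => //.
    apply: (measurableT_comp msin); exact: (measurableT_comp (mtb t b) mZ).
  - by move=> w _; rewrite normrM ler_piMr// sin_max.
  - exact: integrable_norm iZ.
have stein_sin (t : R) : \int[P]_w (Z w * sin (t * Z w + b)) = s ^+ 2 * t * G t.
  have dl (x : R) : is_derive x 1 (fun x : R => t * x + b) t.
    by apply: is_derive_eq; rewrite /GRing.scale /=; ring.
  have cl : continuous (fun x : R => t * x + b).
    by move=> x; apply: cvgD; [apply: cvgM; [exact: cvg_cst|exact: cvg_id]|exact: cvg_cst].
  have h1 (x : R) : is_derive x 1 (fun x : R => sin (t * x + b)) (t * cos (t * x + b)).
    rewrite mulrC.
    exact: (@is_derive1_comp _ sin _ x _ _ (is_derive_sin _) (dl x)).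
  have h2 : continuous (fun x : R => t * cos (t * x + b)).
    move=> x; apply: cvgM; first exact: cvg_cst.
    by apply: continuous_comp; [exact: cl|exact: continuous_cos].
  have h3 (x : R) : `|sin (t * x + b)| <= 1 * (1 + `|x - 0|).
    by rewrite mul1r (le_trans (sin_max _))// lerDl.
  have h4 := integrable_EFinZ measurableT t (icos t).
  have := steinP _ _ _ h1 h2 h3 h4; rewrite RintegralZl// mulrA => <-.
    by apply: eq_Rintegral => w _; rewrite subr0.
  by under [X in EFin \o X]eq_fun do rewrite subr0.
have dG (t : R) : is_derive t 1 G (- (s ^+ 2 * t * G t)).
  rewrite -stein_sin; apply: (@is_derive_quadratic _ _ _ _ (2 * s ^+ 2)) => h.
  have ih := integrable_EFinZ measurableT h (isin t).
  rewrite /G mulrN opprK -RintegralB// -RintegralZl// -RintegralD//; last first.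
    exact: integrable_EFinB.
  have iB : P.-integrable setT (EFin \o (fun w => cos ((t + h) * Z w + b) -
      cos (t * Z w + b) + h * (Z w * sin (t * Z w + b)))).
    by apply: integrable_EFinD => //; exact: integrable_EFinB.
  apply: (le_trans (le_normr_Rintegral _ iB)) => //.
  rewrite -ZZ mulrAC -RintegralZl//.
  apply: le_Rintegral => //.
  - exact: integrable_norm iB.
  - exact: integrable_EFinZ.
  - move=> w _; have := cosD_quadratic (t * Z w + b) (h * Z w).
    rewrite (_ : t * Z w + b + h * Z w = (t + h) * Z w + b); last by ring.
    by rewrite [h * (Z w * _)]mulrA (_ : 2 * (h * Z w) ^+ 2 = 2 * h ^+ 2 * (Z w * Z w))//; ring.
pose D (t : R) := G t * expR (2^-1 * s ^+ 2 * (t * t)).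
have dD (t : R) : is_derive t 1 D 0.
  have dGt := dG t.
  have dq : is_derive t 1 (fun t : R => 2^-1 * s ^+ 2 * (t * t)) (s ^+ 2 * t).
    by apply: is_derive_eq; rewrite /GRing.scale /=; field.
  have dexp := @is_derive1_comp _ expR _ t _ _ (is_derive_expR _) dq.
  apply: is_derive_eq; rewrite /GRing.scale /=; ring.
have G0 : G 0 = cos b.
  rewrite /G; under eq_Rintegral do rewrite mul0r add0r.
  by rewrite Rintegral_cst// [X in fine X]probability_setT mulr1.
have D1 : G 1 * expR (2^-1 * s ^+ 2) = cos b.
  by have := @is_derive_0_is_cst _ D 1 0 dD; rewrite /D !mulr1 !mulr0 expR0 mulr1 G0.
rewrite ZZ expRN -D1 mulfK ?gt_eqF ?expR_gt0//.
by apply: eq_Rintegral => w _; rewrite mul1r.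
Qed.

End gaussian_cos.

(** * Trigonometric polynomials in Gaussian variables *)

Section trig.
Context {R : realType} {I : eqType}.
Implicit Types (l m : seq (R * I)) (x : I -> R) (D : set I).

Definition opp_form l : seq (R * I) := [seq (- p.1, p.2) | p <- l].

Lemma lin_opp_form l x : lin (opp_form l) x = - lin l x.
Proof.
by rewrite lin_map -sumrN; apply: eq_bigr => p _; rewrite mulNr.
Qed.

(* A triple [(c, (l, b))] stands for the function [x |-> c * cos (l(x) + b)],
   where [l] is a linear form in finitely many coordinates of [x]. *)
Definition trig := seq (R * (seq (R * I) * R)).
Implicit Types F G : trig.

Definition tcos x (q : seq (R * I) * R) : R := cos (lin q.1 x + q.2).

Definition teval F x : R := lin F (tcos x).

Definition form_on D l := {in l, forall p, D p.2}.

Definition trig_on D F := {in F, forall q, form_on D q.2.1}.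

Definition tcst (a : R) : trig := [:: (a, ([::], 0))].

Definition tscale (a : R) F : trig := [seq (a * q.1, q.2) | q <- F].

(** The product-to-sum formula for cosines, which makes these expressions an algebra. *)
Definition tmul F G : trig := flatten [seq flatten [seq
  [:: (2^-1 * (q.1 * q'.1), (q.2.1 ++ q'.2.1, q.2.2 + q'.2.2));
      (2^-1 * (q.1 * q'.1), (q.2.1 ++ opp_form q'.2.1, q.2.2 - q'.2.2))]
  | q' <- G] | q <- F].

Definition texp F n : trig := iter n (tmul F) (tcst 1).

(** Stated for arbitrary [k], so as to apply to the values of the cosines and to their
    expectations. *)
Lemma lin_tmul F G (k : seq (R * I) * R -> R) : lin (tmul F G) k =
  lin F (fun q => lin G (fun q' =>
    2^-1 * (k (q.1 ++ q'.1, q.2 + q'.2) + k (q.1 ++ opp_form q'.1, q.2 - q'.2)))).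
Proof.
rewrite /lin big_flatten big_map; apply: eq_bigr => q _.
rewrite big_flatten big_map mulr_sumr; apply: eq_bigr => q' _.
rewrite !big_cons big_nil /=; ring.
Qed.

Lemma teval_cst a x : teval (tcst a) x = a.
Proof. by rewrite /teval /lin big_seq1 /tcos /= /lin big_nil addr0 cos0 mulr1. Qed.

Lemma teval_cat F G x : teval (F ++ G) x = teval F x + teval G x.
Proof. exact: lin_cat. Qed.

Lemma lin_tscale a F (k : seq (R * I) * R -> R) :
  lin (tscale a F) k = a * lin F k.
Proof. by rewrite lin_map mulr_sumr; apply: eq_bigr => q _; rewrite mulrA. Qed.

Lemma teval_scale a F x : teval (tscale a F) x = a * teval F x.
Proof. exact: lin_tscale. Qed.

Lemma teval_mul F G x : teval (tmul F G) x = teval F x * teval G x.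
Proof.
rewrite /teval lin_tmul linM; apply: eq_lin => q _; apply: eq_lin => q' _.
rewrite /tcos /= !lin_cat lin_opp_form.
set a := lin q.2.1 x; set b := lin q'.2.1 x; set u := q.2.2; set v := q'.2.2.
rewrite (_ : a + b + (u + v) = (a + u) + (b + v)); last by ring.
rewrite (_ : a - b + (u - v) = (a + u) - (b + v)); last by ring.
by rewrite cosD cosB; field.
Qed.

Lemma teval_exp F n x : teval (texp F n) x = teval F x ^+ n.
Proof.
by elim: n => [|n IH]; rewrite /= ?teval_cst// teval_mul IH exprS.
Qed.

Lemma form_on_cat D l m : form_on D l -> form_on D m -> form_on D (l ++ m).
Proof. by move=> hl hm p; rewrite mem_cat => /orP[/hl|/hm]. Qed.

Lemma form_on_opp D l : form_on D l -> form_on D (opp_form l).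
Proof. by move=> hl p /mapP[q /hl ? ->]. Qed.

Lemma trig_on_cst D a : trig_on D (tcst a).
Proof. by move=> q; rewrite inE => /eqP -> p. Qed.

Lemma trig_on_cat D F G : trig_on D F -> trig_on D G -> trig_on D (F ++ G).
Proof. by move=> hF hG q; rewrite mem_cat => /orP[/hF|/hG]. Qed.

Lemma trig_on_scale D a F : trig_on D F -> trig_on D (tscale a F).
Proof. by move=> hF _ /mapP[q /hF qD ->]. Qed.

Lemma trig_on_mul D F G : trig_on D F -> trig_on D G -> trig_on D (tmul F G).
Proof.
move=> hF hG q /flatten_mapP[q1 /hF h1] /flatten_mapP[q2 /hG h2].
rewrite !inE => /orP[|] /eqP -> /=; apply: form_on_cat => //.
exact: form_on_opp.
Qed.

Lemma trig_on_exp D F n : trig_on D F -> trig_on D (texp F n).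
Proof.
move=> hF; elim: n => [|n IH]; first exact: trig_on_cst.
exact: trig_on_mul.
Qed.

Definition tnorm F : R := \sum_(q <- F) `|q.1|.

Lemma tnorm_ge0 F : 0 <= tnorm F.
Proof. by apply: sumr_ge0 => q _. Qed.

Lemma teval_le F x : `|teval F x| <= tnorm F.
Proof.
rewrite (le_trans (ler_norm_sum _ _ _))//; apply: ler_sum => q _.
by rewrite normrM ler_piMr// cos_max.
Qed.

Definition treindex {J : eqType} (f : I -> J) F : seq (R * (seq (R * J) * R)) :=
  [seq (q.1, ([seq (p.1, f p.2) | p <- q.2.1], q.2.2)) | q <- F].

End trig.

Arguments trig R I : clear implicits.

Lemma teval_reindex {R : realType} {I J : eqType} (f : I -> J) (F : trig R I)
    (x : J -> R) : teval (treindex f F) x = teval F (x \o f).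
Proof.
rewrite /teval lin_map; apply: eq_bigr => q _; congr (_ * cos (_ + _)).
by rewrite /= lin_map.
Qed.

Lemma measurable_lin {R : realType} {I : eqType} d (T : measurableType d)
    (l : seq (R * I)) (X : I -> T -> R) :
  (forall i, measurable_fun setT (X i)) ->
  measurable_fun setT (fun w => lin l (X^~ w)).
Proof.
move=> mX; elim: l => [|p l IH].
  by rewrite (_ : (fun w => _) = cst 0)//; apply/funext => w; rewrite lin_nil.
rewrite (_ : (fun w => _) = (fun w => p.1 * X p.2 w + lin l (X^~ w))).
  by apply: measurable_funD => //; exact: measurable_funM.
by apply/funext => w; rewrite lin_cons.
Qed.

Lemma measurable_teval {R : realType} {I : eqType} d (T : measurableType d)
    (F : trig R I) (X : I -> T -> R) :
  (forall i, measurable_fun setT (X i)) ->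
  measurable_fun setT (fun w => teval F (X^~ w)).
Proof.
move=> mX; apply: (@measurable_lin _ _ _ _ F (fun q w => tcos (X^~ w) q)) => q.
apply: (measurableT_comp (continuous_measurable_fun (@continuous_cos R))).
by apply: measurable_funD => //; exact: measurable_lin.
Qed.

Lemma integrable_teval {R : realType} {I : eqType} d (T : measurableType d)
    (P : probability T R) (F : trig R I) (X : I -> T -> R) :
  (forall i, measurable_fun setT (X i)) ->
  P.-integrable setT (EFin \o (fun w => teval F (X^~ w))).
Proof.
move=> mX; apply: (@bounded_integrable _ _ _ P _ (tnorm F)) => [|w].
  exact: measurable_teval.
exact: teval_le.
Qed.

Lemma cvg_lin {R : realType} {I : eqType} (l : seq (R * I)) (f : nat -> I -> R)
    (g : I -> R) : {in l, forall p, f n p.2 @[n --> \oo] --> g p.2} ->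
  lin l (f n) @[n --> \oo] --> lin l g.
Proof.
elim: l => [_|p l IH h].
  rewrite lin_nil (_ : (fun n => _) = cst 0); first exact: cvg_cst.
  by apply/funext => n; rewrite lin_nil.
rewrite lin_cons (_ : (fun n => _) = (fun n => p.1 * f n p.2 + lin l (f n))).
  apply: cvgD.
    by apply: cvgMr; apply: h; rewrite mem_head.
  by apply: IH => q ql; apply: h; rewrite inE ql orbT.
by apply/funext => n; rewrite lin_cons.
Qed.

(** * Covariances of linear forms *)

Section bilinear.
Context {R : realType} {I : eqType}.
Variable r : I -> I -> R.
Implicit Types l m : seq (R * I).

Definition bil l m : R := lin l (fun s => lin m (r s)).

Lemma bil_catl l l' m : bil (l ++ l') m = bil l m + bil l' m.
Proof. exact: lin_cat. Qed.

Lemma bil_catr l m m' : bil l (m ++ m') = bil l m + bil l m'.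
Proof. by rewrite /bil -linD; apply: eq_lin => p _; rewrite lin_cat. Qed.

Lemma bil_oppl l m : bil (opp_form l) m = - bil l m.
Proof. exact: lin_opp_form. Qed.

Lemma bil_oppr l m : bil l (opp_form m) = - bil l m.
Proof. by rewrite /bil -linN; apply: eq_lin => p _; rewrite lin_opp_form. Qed.

Lemma bilC l m : (forall s t, r s t = r t s) -> bil l m = bil m l.
Proof.
by move=> rC; rewrite /bil exchange_lin; apply: eq_lin => p _; apply: eq_lin => q _.
Qed.

(** A linear combination of forms as a single form; it starts the induction in Schur's argument. *)
Definition flatten_form (a : seq (R * seq (R * I))) : seq (R * I) :=
  flatten [seq [seq (p.1 * q.1, q.2) | q <- p.2] | p <- a].

Lemma lin_flatten_form (a : seq (R * seq (R * I))) (x : I -> R) :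
  lin (flatten_form a) x = lin a (fun l => lin l x).
Proof.
rewrite /lin big_flatten big_map; apply: eq_bigr => p _.
by rewrite big_map mulr_sumr; apply: eq_bigr => q _ /=; rewrite mulrA.
Qed.

Lemma bil_flatten_form (a b : seq (R * seq (R * I))) :
  bil (flatten_form a) (flatten_form b) = lin a (fun l => lin b (bil l)).
Proof.
rewrite /bil lin_flatten_form; apply: eq_lin => p _.
transitivity (lin p.2 (fun s => lin b (fun m => lin m (r s)))).
  by apply: eq_lin => q _; exact: lin_flatten_form.
by rewrite exchange_lin.
Qed.

Lemma flatten_form_on (D : set I) (a : seq (R * seq (R * I))) :
  {in a, forall p, form_on D p.2} -> form_on D (flatten_form a).
Proof. by move=> h _ /flatten_mapP[p pa /mapP[q ql ->]]; exact: (h p pa q ql). Qed.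

End bilinear.

Section gaussian_trig.
Context {R : realType} {I : eqType} d {T : measurableType d} (P : probability T R).
Variable X : I -> {RV P >-> R}.
Hypothesis gX : gaussian_process X.
Hypothesis cX : centred X.
Variable r : I -> I -> R.
Hypothesis rX : forall s t, ('E_P[X s \* X t] = (r s t)%:E)%E.
Implicit Types l m : seq (R * I).
Local Notation bil := (bil r).

Lemma integrable_sqr s : P.-integrable setT (EFin \o (fun w => X s w * X s w)).
Proof.
apply/integrableP; split; first by apply/measurable_EFinP; exact: measurable_funM.
under eq_integral do rewrite /= ger0_norm -?expr2 ?sqr_ge0//.
by have := rX s s; rewrite unlock => ->; rewrite ltry.
Qed.

Lemma integrable_coord s : P.-integrable setT (EFin \o X s).
Proof. exact/integrable_of_square/integrable_sqr. Qed.

Lemma integrable_coordM s t : P.-integrable setT (EFin \o (fun w => X s w * X t w)).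
Proof.
apply: (@integrable_EFin_le _ _ _ P _ measurableT _ (fun w => X s w * X s w + X t w * X t w)) => //.
- exact: measurable_funM.
- move=> w _; rewrite ler_norml; apply/andP.
  have := sqr_ge0 (X s w - X t w); have := sqr_ge0 (X s w + X t w).
  by split; nra.
- by apply: integrable_EFinD => //; exact: integrable_sqr.
Qed.

Lemma Rintegral_coord s : \int[P]_w X s w = 0.
Proof. by have := cX s; rewrite unlock /Rintegral => ->. Qed.

Lemma Rintegral_coordM s t : \int[P]_w (X s w * X t w) = r s t.
Proof. by have := rX s t; rewrite unlock /Rintegral => ->. Qed.

Definition lform l (w : T) : R := lin l (fun i => X i w).

Lemma measurable_lform l : measurable_fun setT (lform l).
Proof. exact: measurable_lin. Qed.

Lemma lformM l m w : lform l w * lform m w = lin l (fun s => lin m (fun t => X s w * X t w)).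
Proof. exact: linM. Qed.

Lemma integrable_lformM l m : P.-integrable setT (EFin \o (fun w => lform l w * lform m w)).
Proof.
under [X in EFin \o X]eq_fun do rewrite lformM.
apply: integrable_lin => // p _; apply: integrable_lin => // q _.
exact: integrable_coordM.
Qed.

Lemma Rintegral_lformM l m : \int[P]_w (lform l w * lform m w) = bil l m.
Proof.
under eq_Rintegral do rewrite lformM.
have i1 s : P.-integrable setT (EFin \o (fun w => lin m (fun t => X s w * X t w))).
  by apply: integrable_lin => // q _; exact: integrable_coordM.
rewrite Rintegral_lin//; apply: eq_lin => p _; rewrite Rintegral_lin//.
  by apply: eq_lin => q _; exact: Rintegral_coordM.
by move=> q _; exact: integrable_coordM.
Qed.

Lemma cov_sym s t : r s t = r t s.
Proof.
by rewrite -!Rintegral_coordM; apply: eq_Rintegral => w _; rewrite mulrC.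
Qed.

Lemma bil_ge0 l : 0 <= bil l l.
Proof.
by rewrite -Rintegral_lformM; apply: Rintegral_ge0 => w _; rewrite -expr2 sqr_ge0.
Qed.

(** The expectation of cos(l(X) + b). It depends on the process through the covariance only, which
    is what later identifies laws. *)
Definition tmean (q : seq (R * I) * R) : R :=
  cos q.2 * expR (- (2^-1 * bil q.1 q.1)).

Lemma Rintegral_tcos (q : seq (R * I) * R) :
  \int[P]_w tcos (fun i => X i w) q = tmean q.
Proof.
pose Z : {RV P >-> R} := mfun_Sub (mem_set (measurable_lform q.1)).
rewrite /tmean -Rintegral_lformM; apply: (@gaussian_cos _ _ _ P Z).
- exact: integrable_lformM.
- have := gX (fun i : 'I_(size q.1) => (tnth (in_tuple q.1) i).2)
    (fun i => (tnth (in_tuple q.1) i).1).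
  by under eq_fun do rewrite -(big_tnth _ _ _ xpredT (fun p => p.1 * X p.2 _)).
- rewrite /= Rintegral_lin//; last by move=> p _; exact: integrable_coord.
  by rewrite /lin big1// => p _; rewrite Rintegral_coord mulr0.
Qed.

Lemma Rintegral_teval (F : trig R I) :
  \int[P]_w teval F (fun i => X i w) = lin F tmean.
Proof.
rewrite Rintegral_lin//; first by apply: eq_lin => q _; exact: Rintegral_tcos.
move=> q _; apply: (@bounded_integrable _ _ _ P _ 1) => [|w]; last exact: cos_max.
apply: (measurableT_comp (continuous_measurable_fun (@continuous_cos R))).
by apply: measurable_funD => //; exact: measurable_lform.
Qed.

End gaussian_trig.

(** * Covariances of trigonometric polynomials *)

Section decorrelation.
Context {R : realType} {I : eqType} d {T : measurableType d} (P : probability T R).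
Variable X : I -> {RV P >-> R}.
Hypothesis gX : gaussian_process X.
Hypothesis cX : centred X.
Variable r : I -> I -> R.
Hypothesis rX : forall s t, ('E_P[X s \* X t] = (r s t)%:E)%E.
Implicit Types l m : seq (R * I).
Local Notation bil := (bil r).
Local Notation tmean := (tmean r).
Local Notation lform := (lform X).
Local Notation forms := (seq (R * seq (R * I))).

Let iX l m := integrable_lformM rX l m.

Lemma integrable_schur (a b : forms) (k : seq (R * I) -> seq (R * I) -> R) :
  P.-integrable setT (EFin \o (fun w =>
    lin a (fun l => lin b (fun m => k l m * (lform l w * lform m w))))).
Proof.
apply: integrable_lin => // p _; apply: integrable_lin => // q _.
exact: integrable_EFinZ.
Qed.

Lemma Rintegral_schur (a b : forms) (k : seq (R * I) -> seq (R * I) -> R) :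
  \int[P]_w lin a (fun l => lin b (fun m => k l m * (lform l w * lform m w))) =
  lin a (fun l => lin b (fun m => k l m * bil l m)).
Proof.
have i1 l : P.-integrable setT (EFin \o (fun w =>
    lin b (fun m => k l m * (lform l w * lform m w)))).
  by apply: integrable_lin => // q _; exact: integrable_EFinZ.
rewrite Rintegral_lin//; apply: eq_lin => p _; rewrite Rintegral_lin//.
  by apply: eq_lin => q _; rewrite RintegralZl// (Rintegral_lformM rX).
by move=> q _; exact: integrable_EFinZ.
Qed.

Variables (D1 D2 : set I) (rho : R).
Hypothesis linear_corr : forall l m, form_on D1 l -> form_on D2 m ->
  2 * bil l m <= rho * (bil l l + bil m m).

(* Schur's product theorem: multiplying the coefficients of [a] and [b] by the
   values of their forms at a sample point and taking expectations multiplies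
   the kernel by one more factor [bil]. *)
Lemma schur_corr k (a b : forms) :
    {in a, forall p, form_on D1 p.2} -> {in b, forall p, form_on D2 p.2} ->
  2 * lin a (fun l => lin b (fun m => bil l m ^+ k.+1)) <=
  rho * (lin a (fun l => lin a (fun m => bil l m ^+ k.+1)) +
         lin b (fun l => lin b (fun m => bil l m ^+ k.+1))).
Proof.
elim: k a b => [|k IH] a b aD bD.
  have := linear_corr (flatten_form_on aD) (flatten_form_on bD).
  by rewrite !bil_flatten_form.
pose scale w (c : forms) : forms := [seq (p.1 * lform p.2 w, p.2) | p <- c].
have scaleE w (c e : forms) :
    lin (scale w c) (fun l => lin (scale w e) (fun m => bil l m ^+ k.+1)) =
    lin c (fun l => lin e (fun m => bil l m ^+ k.+1 * (lform l w * lform m w))).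
  rewrite lin_map; apply: eq_bigr => p _ /=; rewrite lin_map -mulrA; congr (_ * _).
  by rewrite mulr_sumr; apply: eq_bigr => q _ /=; ring.
have scaleD w (c : forms) D : {in c, forall p, form_on D p.2} ->
    {in scale w c, forall p, form_on D p.2}.
  by move=> cD _ /mapP[p /cD pD ->].
have E (c e : forms) : lin c (fun l => lin e (fun m => bil l m ^+ k.+2)) =
    \int[P]_w lin (scale w c) (fun l => lin (scale w e) (fun m => bil l m ^+ k.+1)).
  under [RHS]eq_Rintegral do rewrite scaleE.
  rewrite Rintegral_schur; apply: eq_lin => p _; apply: eq_lin => q _.
  by rewrite exprSr.
have i (c e : forms) : P.-integrable setT (EFin \o (fun w =>
    lin (scale w c) (fun l => lin (scale w e) (fun m => bil l m ^+ k.+1)))).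
  under [X in EFin \o X]eq_fun do rewrite scaleE.
  exact: integrable_schur.
rewrite !E -RintegralD// -!RintegralZl//; last exact: integrable_EFinD.
apply: le_Rintegral => //.
- exact: integrable_EFinZ.
- by apply: integrable_EFinZ => //; exact: integrable_EFinD.
- by move=> w _; apply: IH; exact: scaleD.
Qed.

(** The covariance of the two cosines: the mean of their product, by product-to-sum, minus the
    product of their means. *)
Definition tcov (q q' : seq (R * I) * R) : R :=
  2^-1 * (tmean (q.1 ++ q'.1, q.2 + q'.2) +
          tmean (q.1 ++ opp_form q'.1, q.2 - q'.2)) - tmean q * tmean q'.

Lemma Rintegral_tevalM (F G : trig R I) :
  \int[P]_w (teval F (fun i => X i w) * teval G (fun i => X i w)) =
  (\int[P]_w teval F (fun i => X i w)) * (\int[P]_w teval G (fun i => X i w)) +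
  lin F (fun q => lin G (tcov q)).
Proof.
under eq_Rintegral do rewrite -teval_mul.
rewrite !(Rintegral_teval gX cX rX) lin_tmul linM -linD; apply: eq_lin => q _.
by rewrite -linD; apply: eq_lin => q' _; rewrite /tcov [RHS]addrC subrK.
Qed.

(** With C the covariance of the two forms, (cos(b - b') e^C + cos(b + b') e^(-C)) / 2 equals cos b
    cos b' cosh C + sin b sin b' sinh C. Hence even powers of C carry cosines and odd ones sines,
    each term splits into a factor of [q], a factor of [q'] and C^k / k!, and the term k = 0 is the
    product of the means. *)
Let amp (q : seq (R * I) * R) : R := expR (- (2^-1 * bil q.1 q.1)).
Let phase k (b : R) : R := if odd k then sin b else cos b.
Let kterm k (q q' : seq (R * I) * R) : R :=
  amp q * phase k q.2 * (amp q' * phase k q'.2) * (k`!%:R^-1 * bil q.1 q'.1 ^+ k).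

(** The amplitudes and phases are moved into the coefficients and 1/k! is a common nonnegative
    factor; what remains is a power of the kernel. *)
Lemma kterm_corr k (F G : trig R I) : trig_on D1 F -> trig_on D2 G ->
  2 * lin F (fun q => lin G (kterm k.+1 q)) <=
  rho * (lin F (fun q => lin F (kterm k.+1 q)) + lin G (fun q => lin G (kterm k.+1 q))).
Proof.
move=> FD GD.
pose coef (H : trig R I) : forms :=
  [seq (q.1 * (amp q.2 * phase k.+1 q.2.2), q.2.1) | q <- H].
have coefE H K : lin H (fun q => lin K (kterm k.+1 q)) = (k.+1)`!%:R^-1 *
    lin (coef H) (fun l => lin (coef K) (fun m => bil l m ^+ k.+1)).
  rewrite lin_map mulr_sumr; apply: eq_bigr => q _ /=.
  rewrite lin_map !mulr_sumr; apply: eq_bigr => q' _ /=.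
  rewrite /kterm; ring.
have coefD H D : trig_on D H -> {in coef H, forall p, form_on D p.2}.
  by move=> HD _ /mapP[q /HD qD ->].
rewrite !coefE -mulrDr mulrCA [leRHS]mulrCA ler_wpM2l ?invr_ge0//.
by apply: schur_corr; exact: coefD.
Qed.

Lemma tcov_series q q' :
  \sum_(k < n) kterm k.+1 q q' @[n --> \oo] --> tcov q q'.
Proof.
set C := bil q.1 q'.1; set b := q.2; set b' := q'.2.
have Cs (l m : seq (R * I)) : bil l m = bil m l.
  by apply: bilC; exact: (cov_sym rX).
have tcovE : tcov q q' = amp q * amp q' * (2^-1 *
    (cos (b - b') * expR C + cos (b + b') * expR (- C))) - kterm 0 q q'.
  rewrite /tcov /tmean /kterm /phase /amp /= -/b -/b' !bil_catl !bil_catr !bil_oppl !bil_oppr.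
  rewrite (Cs q'.1 q.1) -/C opprK fact0 invr1 expr0.
  set v := bil q.1 q.1; set v' := bil q'.1 q'.1.
  rewrite (_ : - (2^-1 * (v + C + (C + v'))) = - (2^-1 * v) + - (2^-1 * v') + - C); last by field.
  rewrite (_ : - (2^-1 * (v - C + (- C + v'))) = - (2^-1 * v) + - (2^-1 * v') + C); last by field.
  by rewrite !expRD; field.
have sE (n : nat) : \sum_(k < n) kterm k.+1 q q' = amp q * amp q' * (2^-1 *
    (cos (b - b') * series (exp_coeff C) n.+1 +
     cos (b + b') * series (exp_coeff (- C)) n.+1)) - kterm 0 q q'.
  rewrite -[LHS](addrK (kterm 0 q q')); congr (_ - _).
  transitivity (\sum_(k < n.+1) kterm k q q'); first by rewrite big_ord_recl addrC.
  rewrite /series /= !big_mkord !mulr_sumr -big_split !mulr_sumr.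
  apply: eq_bigr => k _; have k0 : k`!%:R != 0 :> R by rewrite pnatr_eq0 -lt0n fact_gt0.
  rewrite /kterm /phase /exp_coeff /= exprNn -signr_odd.
  rewrite -/b -/b' (cosD b b') (cosB b b') -/C; case: (odd k) => /=; rewrite ?expr1 ?expr0; field; exact: k0.
rewrite (funext sE) tcovE; apply: cvgB; last exact: cvg_cst.
do 2 (apply: cvgMr).
have cvg_exp (x : R) : series (exp_coeff x) n.+1 @[n --> \oo] --> expR x.
  have := is_cvg_series_exp_coeff x; rewrite -(cvg_shiftS (series (exp_coeff x))).
  exact.
by apply: cvgD; apply: cvgMr; exact: cvg_exp.
Qed.

Lemma tcov_corr (F G : trig R I) : trig_on D1 F -> trig_on D2 G ->
  2 * lin F (fun q => lin G (tcov q)) <=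
  rho * (lin F (fun q => lin F (tcov q)) + lin G (fun q => lin G (tcov q))).
Proof.
move=> FD GD.
have c (H K : trig R I) : lin H (fun q => lin K (fun q' =>
    \sum_(k < n) kterm k.+1 q q')) @[n --> \oo] --> lin H (fun q => lin K (tcov q)).
  apply: cvg_lin => q _; apply: cvg_lin => q' _; exact: tcov_series.
have sumE (H K : trig R I) n : lin H (fun q => lin K (fun q' =>
    \sum_(k < n) kterm k.+1 q q')) =
    \sum_(k < n) lin H (fun q => lin K (kterm k.+1 q)).
  rewrite /lin exchange_big; apply: eq_bigr => q _ /=.
  rewrite -mulr_sumr; congr (_ * _); rewrite exchange_big; apply: eq_bigr => q' _ /=.
  by rewrite mulr_sumr.
pose S n (H K : trig R I) := lin H (fun q => lin K (fun q' =>
  \sum_(k < n) kterm k.+1 q q')).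
have h1 : 2 * S n F G @[n --> \oo] --> 2 * lin F (fun q => lin G (tcov q)).
  by apply: cvgMr; exact: c.
have h2 : rho * (S n F F + S n G G) @[n --> \oo] -->
    rho * (lin F (fun q => lin F (tcov q)) + lin G (fun q => lin G (tcov q))).
  by apply: cvgMr; apply: cvgD; exact: c.
apply: ler_cvg_to h1 h2 _; apply: nearW => n; rewrite /S !sumE -big_split !mulr_sumr; apply: ler_sum => k _.
exact: kterm_corr.
Qed.

End decorrelation.

(** * Approximation of events by trigonometric polynomials *)

Section step_polynomial.
Context {R : realType}.
Implicit Types x y z : R.

(** The polynomials (1 - x^n)^(k^n) of the elementary proof of the Stone-Weierstrass theorem, with k
    = 2 and an extra factor n in the exponent, which makes them tend to 0 at x = 1/2 too. *)
Definition step_poly (n : nat) x : R := (1 - x ^+ n) ^+ (n * 2 ^ n).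

Lemma bernoulli_le y (k : nat) : 0 <= y <= 1 -> 1 - k%:R * y <= (1 - y) ^+ k.
Proof.
move=> /andP[y0 y1]; elim: k => [|k IH]; first by rewrite mul0r subr0 expr0.
rewrite exprS; apply: le_trans (ler_wpM2l _ IH); last by rewrite subr_ge0.
have := ler0n R k; rewrite -natr1; nra.
Qed.

Lemma cvg_natM_expr z : 0 <= z < 1 -> n%:R * z ^+ n @[n --> \oo] --> 0.
Proof.
(* Since z <= w^2, n z^n <= (n w^n) w^n, where n w^n is bounded because (1 + e)^n >= n e for e = 1/w
   - 1. *)
move=> /andP[z0 z1]; pose w := (1 + z) / 2.
have w0 : 0 < w by rewrite /w; lra.
have w1 : w < 1 by rewrite /w; lra.
have zw : z <= w ^+ 2 by rewrite /w; have := sqr_ge0 (1 - z); nra.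
pose e := w^-1 - 1; have e0 : 0 < e by rewrite subr_gt0 invf_gt1.
have nw (n : nat) : n%:R * w ^+ n <= e^-1.
  rewrite -[leRHS]mul1r ler_pdivlMr// mulrAC -ler_pdivlMr ?exprn_gt0//.
  rewrite div1r -exprVn (_ : w^-1 = 1 + e); last by rewrite /e; ring.
  elim: n => [|n IH]; first by rewrite mul0r expr0.
  rewrite exprS -natr1 mulrDl mul1r; have h : 1 <= (1 + e) ^+ n by rewrite exprn_ege1 ?lerDl ?ltW.
  by move: IH h; set p := _ ^+ n; move: (n%:R * e) => u *; nra.
apply: (@squeeze_cvgr _ _ _ _ (fun=> 0) (fun n => e^-1 * w ^+ n)); last 2 first.
- exact: cvg_cst.
- rewrite -(mulr0 e^-1); apply: cvgMr.
  by apply: cvg_expr; rewrite ger0_norm ?ltW.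
apply: nearW => n; rewrite mulr_ge0 ?exprn_ge0//=.
apply: (@le_trans _ _ (n%:R * (w ^+ 2) ^+ n)).
  by rewrite ler_wpM2l// lerXn2r ?nnegrE ?exprn_ge0 ?(ltW w0)//.
by rewrite -exprM mul2n -addnn exprD mulrA ler_wpM2r ?exprn_ge0 ?(ltW w0)//.
Qed.

Lemma step_poly_itv (n : nat) x : 0 <= x <= 1 -> 0 <= step_poly n x <= 1.
Proof.
move=> /andP[x0 x1]; have h : 0 <= 1 - x ^+ n <= 1.
  by rewrite subr_ge0 exprn_ile1//= lerBlDr lerDl exprn_ge0.
by case/andP: h => h0 h1; rewrite exprn_ge0//= exprn_ile1.
Qed.

(** Below 1/2, Bernoulli's inequality gives at least 1 - n (2x)^n; from 1/2 on, 1 - y <= e^(-y)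
    gives at most e^(-n). *)
Lemma cvg_step_poly x : 0 <= x <= 1 ->
  step_poly n x @[n --> \oo] --> ((x < 2^-1)%R%:R : R).
Proof.
move=> x01; have /andP[x0 x1] := x01.
have [xlt|xge] := ltP x 2^-1.
  apply: (@squeeze_cvgr _ _ _ _ (fun n => 1 - n%:R * (2 * x) ^+ n) (fun=> 1)); last 2 first.
  - rewrite -[X in _ --> X]subr0; apply: cvgB; first exact: cvg_cst.
    by apply: cvg_natM_expr; apply/andP; split; lra.
  - exact: cvg_cst.
  apply: nearW => n; have /andP[_ ->] := step_poly_itv n x01; rewrite andbT.
  apply: le_trans (bernoulli_le _ _); last by rewrite exprn_ge0 ?exprn_ile1.
  by rewrite natrM natrX exprMn mulrA.
apply: (@squeeze_cvgr _ _ _ _ (fun=> 0) (fun n => expR (- 1) ^+ n)); last 2 first.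
- exact: cvg_cst.
- by apply: cvg_expr; rewrite ger0_norm ?expR_ge0 ?expR_lt1 ?ltrN10.
apply: nearW => n; have /andP[-> _] /= := step_poly_itv n x01.
rewrite /step_poly mulnC exprM; apply: lerXn2r; rewrite ?nnegrE ?expR_ge0 ?exprn_ge0 ?subr_ge0 ?exprn_ile1//.
have h : 1 - x ^+ n <= expR (- (2^-1) ^+ n).
  apply: (@le_trans _ _ (1 - 2^-1 ^+ n)); last exact: expR_ge1Dx.
  by rewrite lerB// lerXn2r ?nnegrE.
apply: (@le_trans _ _ (expR (- 2^-1 ^+ n) ^+ (2 ^ n))).
  by apply: lerXn2r; rewrite ?nnegrE ?expR_ge0 ?subr_ge0 ?exprn_ile1.
by rewrite -expRM_natl natrX mulrN -exprMn mulfV// expr1n.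
Qed.

End step_polynomial.

(** * Mean square error of bounded functions *)

Section square_error.
Context {R : realType} d {T : measurableType d} (P : probability T R).
Implicit Types f g h : T -> R.

Definition bounded_measurable f :=
  measurable_fun setT f /\ exists M : R, forall w, `|f w| <= M.

Definition sqerr f g : R := \int[P]_w (f w - g w) ^+ 2.

Lemma bounded_measurable_integrable f :
  bounded_measurable f -> P.-integrable setT (EFin \o f).
Proof. by case=> mf [M fM]; exact: (bounded_integrable P mf fM). Qed.

Lemma bounded_measurableM f g : bounded_measurable f -> bounded_measurable g ->
  bounded_measurable (fun w => f w * g w).
Proof.
move=> [mf [M fM]] [mg [N gN]]; split; first exact: measurable_funM.
by exists (M * N) => w; rewrite normrM ler_pM.
Qed.

Lemma bounded_measurableB f g : bounded_measurable f -> bounded_measurable g ->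
  bounded_measurable (fun w => f w - g w).
Proof.
move=> [mf [M fM]] [mg [N gN]]; split; first exact: measurable_funB.
by exists (M + N) => w; rewrite (le_trans (ler_normB _ _))// lerD.
Qed.

Lemma bounded_measurable_sqr f g : bounded_measurable f -> bounded_measurable g ->
  bounded_measurable (fun w => (f w - g w) ^+ 2).
Proof.
move=> bf bg; have b := bounded_measurableB bf bg.
exact: (bounded_measurableM b b).
Qed.

Lemma bounded_measurable_indic (A : set T) : measurable A ->
  bounded_measurable (\1_A : T -> R).
Proof.
move=> mA; split; first exact: measurable_indic.
by exists 1 => w; rewrite indicE; case: (_ \in _); rewrite ?normr1 ?normr0.
Qed.

Lemma sqerr_triangle f g h : bounded_measurable f -> bounded_measurable g ->
  bounded_measurable h -> sqerr f h <= 2 * sqerr f g + 2 * sqerr g h.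
Proof.
move=> bf bg bh; rewrite /sqerr.
have i1 := bounded_measurable_integrable (bounded_measurable_sqr bf bg).
have i2 := bounded_measurable_integrable (bounded_measurable_sqr bg bh).
have i3 := bounded_measurable_integrable (bounded_measurable_sqr bf bh).
rewrite -!RintegralZl// -RintegralD//; [|exact: integrable_EFinZ..].
apply: le_Rintegral => //.
  by apply: integrable_EFinD => //; exact: integrable_EFinZ.
by move=> w _; have := sqr_ge0 (f w - 2 * g w + h w); nra.
Qed.

Lemma sqr_Rintegral_le f g : bounded_measurable f -> bounded_measurable g ->
  (\int[P]_w f w - \int[P]_w g w) ^+ 2 <= sqerr f g.
Proof.
move=> bf bg; have bh := bounded_measurableB bf bg.
have ih := bounded_measurable_integrable bh.
rewrite -RintegralB; [|by []|exact: bounded_measurable_integrable..].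
have one : \int[P]_w (1 * 1) = 1 :> R.
  by rewrite mulr1 Rintegral_cst// [X in fine X]probability_setT mulr1.
have i1 := bounded_measurable_integrable (bounded_measurableM bh bh).
have i2 : P.-integrable setT (EFin \o (fun w => (f w - g w) * 1)).
  by under [X in EFin \o X]eq_fun do rewrite mulr1.
have i3 : P.-integrable setT (EFin \o (fun _ : T => 1 * 1 : R)).
  exact: finite_measure_integrable_cst.
have := Rintegral_cauchy_schwarz i1 i2 i3; rewrite one mulr1.
by under [in X in X ^+ 2 <= _ -> _]eq_Rintegral do rewrite mulr1.
Qed.

Lemma cvg_sqerr (f : T -> R) (fn : nat -> T -> R) (M : R) :
    bounded_measurable f -> (forall n, measurable_fun setT (fn n)) ->
    (forall n w, `|fn n w| <= M) -> (forall w, fn n w @[n --> \oo] --> f w) ->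
  sqerr f (fn n) @[n --> \oo] --> 0.
Proof.
move=> [mf [N fN]] mfn fnM fnf.
have mg n : measurable_fun setT (fun w => (f w - fn n w) ^+ 2).
  by apply: measurable_funX; exact: measurable_funB.
have [] := @dominated_convergence _ _ _ P setT measurableT
  (fun n w => ((f w - fn n w) ^+ 2)%:E) (cst 0%E) (cst ((N + M) ^+ 2)%:E).
- by move=> n; exact/measurable_EFinP.
- exact: measurable_cst.
- apply: aeW => w _; apply: cvg_EFin; first exact: nearW.
  rewrite -[X in _ --> X](expr0n _ 2) -[X in X ^+ 2](subrr (f w)).
  rewrite [X in X @ _](_ : _ = (fun n => (f w - fn n w) * (f w - fn n w)))//.
  rewrite expr2; have h : f w - fn n w @[n --> \oo] --> f w - f w.
    by apply: cvgB => //; exact: cvg_cst.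
  exact: cvgM.
- exact: finite_measure_integrable_cst.
- apply: aeW => w n _; rewrite lee_fin normrX lerXn2r ?nnegrE ?addr_ge0//.
  + exact: le_trans (normr_ge0 _) (fN w).
  + exact: le_trans (normr_ge0 _) (fnM 0%N w).
  + by rewrite (le_trans (ler_normB _ _))// lerD.
by move=> _ _; rewrite integral0 => /fine_cvg.
Qed.

End square_error.

(** * Events approximable by trigonometric polynomials *)

Section approximation.
Context {R : realType} d {T : measurableType d} (P : probability T R).
Context {I : eqType} {Omega : Type}.
Variables (xi : I -> Omega -> R) (D : set I) (J : finType) (Phi : J -> T -> Omega).
Hypothesis mxi : forall j i, measurable_fun setT (fun w => xi i (Phi j w)).

Definition tfun (F : trig R I) (o : Omega) : R := teval F (fun i => xi i o).

Lemma bounded_measurable_tfun F j : bounded_measurable (fun w => tfun F (Phi j w)).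
Proof.
split; first exact: measurable_teval.
by exists (tnorm F) => w; exact: teval_le.
Qed.

(** One polynomial has to serve all the finitely many maps [Phi j] at once: this is what allows a
    process and its shift to be compared. *)
Definition approximable (E : set Omega) :=
  (forall j, measurable (Phi j @^-1` E)) /\
  forall e : R, 0 < e -> exists2 F, trig_on D F &
    forall j, sqerr P (\1_E \o Phi j) (fun w => tfun F (Phi j w)) <= e.

Lemma bounded_measurable_event E j : measurable (Phi j @^-1` E) ->
  bounded_measurable (\1_E \o Phi j : T -> R).
Proof.
move=> mE; have := @bounded_measurable_indic R _ _ _ mE.
by congr bounded_measurable; apply/funext => w; rewrite /= !indicE.
Qed.

Lemma approximable0 : approximable set0.
Proof.
split=> [j|e e0]; first by rewrite preimage_set0.
exists [::] => [//|j]; rewrite /sqerr /Rintegral integral0_eq ?ltW// => w _.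
by rewrite /tfun /teval lin_nil /= indicE in_set0 subr0 expr0n.
Qed.

Lemma approximableC E : approximable E -> approximable (~` E).
Proof.
move=> [mE aE]; split=> [j|e e0]; first by rewrite preimage_setC; apply: measurableC; exact: mE.
have [F FD Fe] := aE e e0; exists (tcst 1 ++ tscale (-1) F).
  by apply: trig_on_cat; [exact: trig_on_cst|exact: trig_on_scale].
move=> j; apply: le_trans (Fe j); rewrite le_eqVlt; apply/orP; left; apply/eqP.
apply: eq_Rintegral => w _; rewrite /tfun teval_cat teval_cst teval_scale /=.
by rewrite !indicE in_setC; case: (_ \in _) => /=; ring.
Qed.

Lemma approximableI E1 E2 : approximable E1 -> approximable E2 ->
  approximable (E1 `&` E2).
Proof.
move=> [m1 a1] [m2 a2]; split=> [j|e e0].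
  by rewrite preimage_setI; exact: measurableI.
have key (u v f g m : R) : u ^+ 2 <= 1 -> g ^+ 2 <= m ->
    (u * v - f * g) ^+ 2 <= 2 * (v - g) ^+ 2 + 2 * m * (u - f) ^+ 2.
  move=> u1 gm; rewrite -subr_ge0.
  have -> : 2 * (v - g) ^+ 2 + 2 * m * (u - f) ^+ 2 - (u * v - f * g) ^+ 2 =
    2 * ((1 - u ^+ 2) * (v - g) ^+ 2) + 2 * ((m - g ^+ 2) * (u - f) ^+ 2) +
    (u * (v - g) - g * (u - f)) ^+ 2 by ring.
  by rewrite !addr_ge0 ?sqr_ge0// mulr_ge0// mulr_ge0 ?sqr_ge0 ?subr_ge0.
(* G is chosen first, because its sup bound M enters the accuracy required of F. *)
have [G GD Ge] := a2 (e / 4) ltac:(by rewrite divr_gt0).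
have M0 := tnorm_ge0 G; set M := tnorm G in M0.
have M1 : 0 < 4 * (M ^+ 2 + 1) by have := sqr_ge0 M; nra.
have [F FD Fe] := a1 (e / (4 * (M ^+ 2 + 1))) ltac:(by rewrite divr_gt0).
exists (tmul F G) => [|j]; first exact: trig_on_mul.
have b1 := bounded_measurable_event (m1 j).
have b2 := bounded_measurable_event (m2 j).
have bF := bounded_measurable_tfun F j; have bG := bounded_measurable_tfun G j.
apply: (@le_trans _ _ (2 * sqerr P (\1_E2 \o Phi j) (fun w => tfun G (Phi j w)) +
    2 * M ^+ 2 * sqerr P (\1_E1 \o Phi j) (fun w => tfun F (Phi j w)))).
  rewrite /sqerr.
  have i1 := bounded_measurable_integrable P (bounded_measurable_sqr b1 bF).
  have i2 := bounded_measurable_integrable P (bounded_measurable_sqr b2 bG).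
  rewrite -!RintegralZl// -RintegralD//; [|exact: integrable_EFinZ..].
  apply: le_Rintegral => //.
  - apply: bounded_measurable_integrable; apply: bounded_measurable_sqr.
      by apply: bounded_measurable_event; rewrite preimage_setI; exact: measurableI.
    exact: bounded_measurable_tfun.
  - by apply: integrable_EFinD => //; exact: integrable_EFinZ.
  move=> w _; rewrite /tfun teval_mul /= !indicE in_setI.
  set f := teval F _; set g := teval G _.
  have gM : g ^+ 2 <= M ^+ 2.
    by rewrite -(@real_normK _ g) ?num_real// lerXn2r ?nnegrE// teval_le.
  have u1 : (Phi j w \in E1)%:R ^+ 2 <= 1 :> R by case: (_ \in _); rewrite ?expr1n ?expr0n.
  rewrite -mulnb natrM; exact: key.
apply: (@le_trans _ _ (2 * (e / 4) + 2 * M ^+ 2 * (e / (4 * (M ^+ 2 + 1))))).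
  by apply: lerD; rewrite ler_wpM2l// mulr_ge0 ?sqr_ge0.
set t := e / (4 * _); have t0 : 0 <= t by rewrite divr_ge0 ?ltW.
have te : t * (4 * (M ^+ 2 + 1)) = e by rewrite divfK ?gt_eqF.
have := sqr_ge0 M; nra.
Qed.

Lemma approximable_lim E (F : nat -> trig R I) (M : R) :
    (forall j, measurable (Phi j @^-1` E)) -> (forall n, trig_on D (F n)) ->
    (forall n o, `|tfun (F n) o| <= M) ->
    (forall o, tfun (F n) o @[n --> \oo] --> (\1_E o : R)) ->
  approximable E.
Proof.
move=> mE FD FM FE; split=> // e e0.
have h j : \forall n \near \oo,
    sqerr P (\1_E \o Phi j) (fun w => tfun (F n) (Phi j w)) <= e.
  have mF n : measurable_fun setT (fun w => tfun (F n) (Phi j w)).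
    by case: (bounded_measurable_tfun (F n) j).
  have /cvgrPdist_le/(_ e e0) := cvg_sqerr P (bounded_measurable_event (mE j))
    mF (fun n w => FM n (Phi j w)) (fun w => FE (Phi j w)).
  by apply: filterS => n; rewrite sub0r normrN; apply: le_trans; exact: ler_norm.
have [N _ /(_ N (leqnn N)) hN] : \forall n \near \oo, forall j,
    sqerr P (\1_E \o Phi j) (fun w => tfun (F n) (Phi j w)) <= e.
  exact: filter_forall.
by exists (F N).
Qed.

Lemma approximable_limset E (A : nat -> set Omega) :
    (forall n, approximable (A n)) ->
    (forall j, measurable (Phi j @^-1` E)) ->
    (forall o, \1_(A n) o @[n --> \oo] --> (\1_E o : R)) ->
  approximable E.
Proof.
move=> aA mE AE; split=> // e e0; have e4 : 0 < e / 4 by rewrite divr_gt0.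
have h j : \forall n \near \oo,
    sqerr P (\1_E \o Phi j) (\1_(A n) \o Phi j) <= e / 4.
  have mA n : measurable_fun setT (\1_(A n) \o Phi j : T -> R).
    by case: (bounded_measurable_event (proj1 (aA n) j)).
  have A1 n w : `|(\1_(A n) \o Phi j) w| <= 1 :> R.
    by rewrite /= indicE; case: (_ \in _); rewrite ?normr1 ?normr0.
  have /cvgrPdist_le/(_ _ e4) := cvg_sqerr P (bounded_measurable_event (mE j))
    mA A1 (fun w => AE (Phi j w)).
  by apply: filterS => n; rewrite sub0r normrN; apply: le_trans; exact: ler_norm.
have [N _ /(_ N (leqnn N)) hN] : \forall n \near \oo, forall j,
    sqerr P (\1_E \o Phi j) (\1_(A n) \o Phi j) <= e / 4.
  exact: filter_forall.
have [mA /(_ _ e4)[F FD FA]] := aA N; exists F => // j.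
have := sqerr_triangle P (bounded_measurable_event (mE j))
  (bounded_measurable_event (mA j)) (bounded_measurable_tfun F j).
by move=> /le_trans; apply; have := FA j; have := hN j; lra.
Qed.

(** Finite unions come from complements and intersections, and their indicators converge pointwise
    to that of the countable union. *)
Lemma approximable_bigcup (A : nat -> set Omega) :
  (forall n, approximable (A n)) -> approximable (\bigcup_n A n).
Proof.
move=> aA.
have aU n : approximable (\bigcup_(k < n) A k).
  elim: n => [|n IH]; first by rewrite bigcup_mkord big_ord0; exact: approximable0.
  rewrite bigcup_mkord big_ord_recr -bigcup_mkord -[X in approximable X]setCK setCU.
  by apply: approximableC; apply: approximableI; exact: approximableC.
apply: approximable_limset aU _ _ => [j|o].
  by rewrite preimage_bigcup; apply: bigcup_measurable => n _; case: (aA n).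
have [[n _ Ano]|no] := pselect ((\bigcup_n A n) o).
  apply: cvg_near_cst; near=> m; rewrite !indicE !mem_set//; first by exists n.
  by exists n => //=; near: m; exact: nbhs_infty_gt.
apply: cvg_near_cst; apply: nearW => m; rewrite !indicE !memNset// => -[k _ Ako].
by apply: no; exists k.
Unshelve. all: by end_near. Qed.

Lemma sigma_algebra_approximable : sigma_algebra setT approximable.
Proof.
split; [exact: approximable0|move=> A|exact: approximable_bigcup].
by rewrite setTD; exact: approximableC.
Qed.

Lemma measurable_xi_gt i c j : measurable (Phi j @^-1` [set o | c < xi i o]).
Proof.
have := mxi j i measurableT (measurable_itv `]c, +oo[).
rewrite setTI; congr measurable; apply/seteqP; split => w /=;
  by rewrite in_itv/= andbT.
Qed.

(** The event says that the trigonometric polynomial (1 - sin) / 2, with values in [0, 1], is below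
    1/2; composing it with [step_poly] gives trigonometric polynomials again. *)
Lemma approximable_sin_gt0 i a b : D i ->
  approximable [set o | 0 < sin (a * xi i o + b)].
Proof.
move=> Di; pose S : trig R I := [:: (1, ([:: (a, i)], b - pi / 2))].
have SE o : tfun S o = sin (a * xi i o + b).
  by rewrite /tfun /teval /lin !big_seq1 /tcos /= /lin big_seq1 mul1r addrA cosBpihalf.
pose G := tcst 2^-1 ++ tscale (- 2^-1) S.
have GE o : tfun G o = (1 - sin (a * xi i o + b)) / 2.
  by rewrite /tfun teval_cat teval_cst teval_scale -[teval S _]/(tfun S o) SE; field.
have GD : trig_on D G.
  apply: trig_on_cat; first exact: trig_on_cst.
  by apply: trig_on_scale => q; rewrite inE => /eqP -> p; rewrite inE => /eqP ->.
pose F (n : nat) := texp (tcst 1 ++ tscale (-1) (texp G n)) (n * 2 ^ n).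
have FE (n : nat) o : tfun (F n) o = step_poly n (tfun G o).
  by rewrite /tfun teval_exp teval_cat teval_cst teval_scale teval_exp mulN1r.
have G01 o : 0 <= tfun G o <= 1.
  by rewrite GE; have := sin_le1 (a * xi i o + b); have := sin_geN1 (a * xi i o + b); lra.
apply: (@approximable_lim _ F 1).
- move=> j.
  have ms : measurable_fun setT (fun w => sin (a * xi i (Phi j w) + b)).
    apply: (measurableT_comp (continuous_measurable_fun (@continuous_sin R))).
    by apply: measurable_funD => //; exact: measurable_funM.
  have := ms measurableT _ (measurable_itv `]0, +oo[).
  rewrite setTI; congr measurable; apply/seteqP; split => w /=;
    by rewrite in_itv/= andbT.
- move=> n; apply: trig_on_exp; apply: trig_on_cat; first exact: trig_on_cst.
  by apply: trig_on_scale; exact: trig_on_exp.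
- move=> n o; rewrite FE; have /andP[h0 h1] := step_poly_itv n (G01 o).
  by rewrite ger0_norm.
- move=> o; rewrite (_ : (fun n => _) = (fun n => step_poly n (tfun G o))); last first.
    by apply/funext => n; exact: FE.
  rewrite indicE (_ : (o \in _) = (tfun G o < 2^-1)); first exact: cvg_step_poly.
  rewrite GE; apply/idP/idP; first by move=> /set_mem /=; lra.
  by move=> h; rewrite mem_set//=; lra.
Qed.

(** For large n, (xi - c) / (n + 1) lies in ]-pi, pi[, where the sine has the sign of its
    argument. *)
Lemma approximable_gt i c : D i -> approximable [set o | c < xi i o].
Proof.
move=> Di; apply: (@approximable_limset _
  (fun n => [set o | 0 < sin (n.+1%:R^-1 * xi i o + - (n.+1%:R^-1 * c))])).
- by move=> n; exact: approximable_sin_gt0.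
- exact: measurable_xi_gt.
- move=> o; apply: cvg_near_cst; near=> n; rewrite !indicE; congr ((nat_of_bool _)%:R).
  have n0 : (0 : R) < n.+1%:R^-1 by rewrite invr_gt0.
  have small : `|n.+1%:R^-1 * (xi i o - c)| < pi.
    rewrite normrM gtr0_norm// mulrC ltr_pdivrMr//.
    have : `|xi i o - c| <= n%:R by near: n; exact: nbhs_infty_ger.
    by have := @pi_ge2 R; rewrite -natr1; have := ler0n R n; nra.
  have E (o' : Omega) : n.+1%:R^-1 * xi i o' + - (n.+1%:R^-1 * c) = n.+1%:R^-1 * (xi i o' - c) by ring.
  apply/idP/idP => /set_mem /=; rewrite ?E => h; apply/mem_set => /=; rewrite ?E.
    rewrite ltNge; apply/negP => xc; move: h; rewrite ltNge => /negP; apply.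
    rewrite -oppr_ge0 -sinN sin_ge0_pi//; move: small; rewrite ltr_norml => /andP[h1 h2].
    by apply/andP; split; [rewrite oppr_ge0 pmulr_rle0// subr_le0|rewrite lerNl ltW].
  apply: sin_gt0_pi; apply/andP; split; first by rewrite pmulr_rgt0// subr_gt0.
  by move: small; rewrite ltr_norml => /andP[].
Unshelve. all: by end_near. Qed.

Lemma approximable_sigma (E : set Omega) :
  <<s \bigcup_(i in D) preimage_set_system setT (xi i) measurable >> E ->
  approximable E.
Proof.
move: E; apply: smallest_sub; first exact: sigma_algebra_approximable.
move=> _ [i Di [B mB <-]]; rewrite setTI.
have sB : sigma_algebra setT [set B : set R | approximable (xi i @^-1` B)].
  have [a0 aC aU] := sigma_algebra_approximable; split => /=.
  - by rewrite preimage_set0.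
  - by move=> A; rewrite setTD preimage_setC -setTD; exact: aC.
  - by move=> A hA; rewrite preimage_bigcup; exact: aU.
suff : measurable `<=` [set B : set R | approximable (xi i @^-1` B)] by exact.
have -> : (measurable : set (set R)) = <<s @RGenOInfty.G R >>.
  exact: RGenOInfty.measurableE.
apply: smallest_sub => // _ [c ->] /=.
have := approximable_gt c Di; congr approximable; apply/seteqP; split => o /=;
  by rewrite in_itv/= andbT.
Qed.

End approximation.

(** * From trigonometric polynomials to events *)

Section square_error_product.
Context {R : realType} d {T : measurableType d} (P : probability T R).
Implicit Types f g a b : T -> R.

Lemma Rintegral_prod_le f g (x y : R) : bounded_measurable f -> bounded_measurable g ->
    0 <= x -> 0 <= y ->
    \int[P]_w (f w) ^+ 2 <= x ^+ 2 -> \int[P]_w (g w) ^+ 2 <= y ^+ 2 ->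
  `|\int[P]_w (f w * g w)| <= x * y.
Proof.
move=> bf bg x0 y0 fx gy.
have := @Rintegral_cauchy_schwarz _ _ _ P f g
  (bounded_measurable_integrable P (bounded_measurableM bf bf))
  (bounded_measurable_integrable P (bounded_measurableM bf bg))
  (bounded_measurable_integrable P (bounded_measurableM bg bg)).
move=> cs; rewrite -ler_sqr ?nnegrE ?mulr_ge0// real_normK ?num_real//.
apply: (le_trans cs); rewrite exprMn ler_pM//;
  by apply: Rintegral_ge0 => w _; rewrite -expr2 sqr_ge0.
Qed.

(** From fg - ab = (a - f)(b - g) - a(b - g) - (a - f)b, which needs sup bounds for a and b only;
    each term costs at most e. *)
Lemma sqerr_prod a b f g (e : R) : bounded_measurable a -> bounded_measurable b ->
    bounded_measurable f -> bounded_measurable g ->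
    (forall w, `|a w| <= 1) -> (forall w, `|b w| <= 1) -> 0 <= e <= 1 ->
    sqerr P a f <= e ^+ 2 -> sqerr P b g <= e ^+ 2 ->
  `|\int[P]_w (f w * g w) - \int[P]_w (a w * b w)| <= 3 * e.
Proof.
move=> ba bb bf bg a1 b1 /andP[e0 e1] af bg'.
have buf := bounded_measurableB ba bf; have bvg := bounded_measurableB bb bg.
have sq1 (h : T -> R) : bounded_measurable h -> (forall w, `|h w| <= 1) ->
    \int[P]_w (h w) ^+ 2 <= 1 ^+ 2.
  move=> bh h1; have -> : (1 : R) ^+ 2 = \int[P]_w 1.
    by rewrite Rintegral_cst// [X in fine X]probability_setT expr1n mulr1.
  apply: le_Rintegral => //.
  - exact: (bounded_measurable_integrable P (bounded_measurableM bh bh)).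
  - exact: finite_measure_integrable_cst.
  - by move=> w _; rewrite -real_normK ?num_real// expr_le1.
have h1 := Rintegral_prod_le buf bvg e0 e0 af bg'.
have h2 := Rintegral_prod_le ba bvg ler01 e0 (sq1 _ ba a1) bg'.
have h3 := Rintegral_prod_le buf bb e0 ler01 af (sq1 _ bb b1).
have i u v (bu : bounded_measurable u) (bv : bounded_measurable v) :=
  bounded_measurable_integrable P (bounded_measurableM bu bv).
have i1 := i _ _ buf bvg; have i2 := i _ _ ba bvg; have i3 := i _ _ buf bb.
have i4 := i _ _ bf bg; have i5 := i _ _ ba bb.
have -> : \int[P]_w (f w * g w) - \int[P]_w (a w * b w) =
    \int[P]_w ((a w - f w) * (b w - g w)) - \int[P]_w (a w * (b w - g w)) -
    \int[P]_w ((a w - f w) * b w).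
  rewrite -!RintegralB//; last exact: integrable_EFinB.
  by apply: eq_Rintegral => w _; ring.
rewrite (le_trans (ler_normB _ _))// (_ : 3 * e = (1 * e + 1 * e) + e * 1); last by ring.
apply: lerD => //; rewrite (le_trans (ler_normB _ _))// lerD//.
by rewrite (le_trans h1)// ler_wpM2r.
Qed.

End square_error_product.

Section gaussian_mixing.
Context {R : realType} {I : eqType} d {T : measurableType d} (P : probability T R).
Variable X : I -> {RV P >-> R}.
Hypothesis gX : gaussian_process X.
Hypothesis cX : centred X.
Variable r : I -> I -> R.
Hypothesis rX : forall s t, ('E_P[X s \* X t] = (r s t)%:E)%E.
Variables (D1 D2 : set I) (rho : R).
Hypothesis rho0 : 0 <= rho.
Hypothesis linear_corr : forall l m, form_on D1 l -> form_on D2 m ->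
  2 * bil r l m <= rho * (bil r l l + bil r m m).

Let probability_01 (A : set T) : measurable A -> 0 <= fine (P A) <= 1.
Proof.
move=> mA; rewrite fine_ge0//= -lee_fin fineK ?fin_num_measure//.
exact: probability_le1.
Qed.

(** Here a, b, ab stand for P(A), P(B), P(A & B), and mf, mg, tfg, tff, tgg for the means and
    covariances of the approximating polynomials. An indicator has variance p - p^2 <= 1/4, and the
    choice of k absorbs the errors. *)
Let covariance_perturbation (a b ab mf mg tfg tff tgg e k e0 : R) :
    k = 12 * (rho + 1) -> 0 < e -> e <= 1 -> e * k <= e0 ->
    0 <= a <= 1 -> 0 <= b <= 1 ->
    2 * tfg <= rho * (tff + tgg) ->
    `|mf * mg + tfg - ab| <= 3 * e -> `|mf * mf + tff - a| <= 3 * e ->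
    `|mg * mg + tgg - b| <= 3 * e -> `|a - mf| <= e -> `|b - mg| <= e ->
  ab - a * b <= rho + e0.
Proof.
move=> -> e0' e1 ek /andP[a0 a1] /andP[b0 b1] t.
rewrite !ler_norml => /andP[h1 h2] /andP[h3 h4] /andP[h5 h6] /andP[h7 h8] /andP[h9 h10].
have tfgE : ab - a * b - 6 * e <= tfg.
  have : mf * mg <= a * b + 3 * e by nra.
  lra.
have var (p m tt : R) : 0 <= p -> p <= 1 -> p - e <= m -> m <= p + e ->
    m * m + tt - p <= 3 * e -> tt <= 4^-1 + 5 * e.
  by move=> *; have := sqr_ge0 (p - 2^-1); nra.
have hf : tff <= 4^-1 + 5 * e by apply: (var a mf); lra.
have hg : tgg <= 4^-1 + 5 * e by apply: (var b mg); lra.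
have hr : rho * (tff + tgg) <= rho * (2^-1 + 10 * e) by rewrite ler_wpM2l//; lra.
have re : 0 <= rho * e by rewrite mulr_ge0// ltW.
nra.
Qed.

Let EP (A : set T) : measurable A -> \int[P]_w \1_A w = fine (P A).
Proof. by move=> mA; rewrite /Rintegral integral_indic// setIT. Qed.

Lemma covariance_event_le (A B : set T) : sigma_of X D1 A -> sigma_of X D2 B ->
  fine (P (A `&` B)) - fine (P A) * fine (P B) <= rho.
Proof.
move=> sA sB.
have mX (j : unit) (i : I) : measurable_fun setT (fun w => X i (id w)) by [].
have [mA aA] := @approximable_sigma R _ T P I T (fun i w => X i w) D1 unit
  (fun _ w => w) mX A sA.
have [mB aB] := @approximable_sigma R _ T P I T (fun i w => X i w) D2 unit
  (fun _ w => w) mX B sB.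
have {}mA : measurable A := mA tt; have {}mB : measurable B := mB tt.
apply/ler_addgt0Pr => e0 e0_gt0.
pose k := 12 * (rho + 1).
have k0 : 0 < k by rewrite mulr_gt0// ltr_wpDl.
pose e := Num.min 1 (e0 / k).
have egt0 : 0 < e by rewrite lt_min ltr01 divr_gt0.
have e1 : e <= 1 by rewrite ge_min lexx.
have ek : e * k <= e0 by rewrite -ler_pdivlMr// ge_min lexx orbT.
have e2 : 0 < e ^+ 2 by rewrite exprn_gt0.
have [F FD /(_ tt) Fe] := aA _ e2; have [G GD /(_ tt) Ge] := aB _ e2.
pose f w := tfun (fun i w => X i w) F w; pose g w := tfun (fun i w => X i w) G w.
have bf : bounded_measurable f by exact: (bounded_measurable_tfun mX F tt).
have bg : bounded_measurable g by exact: (bounded_measurable_tfun mX G tt).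
have ba := bounded_measurable_indic (R := R) mA.
have bb := bounded_measurable_indic (R := R) mB.
have ind1 (C : set T) w : `|\1_C w| <= 1 :> R.
  by rewrite indicE; case: (_ \in _); rewrite ?normr1 ?normr0.
have e01 : 0 <= e <= 1 by rewrite ltW.
have fg := sqerr_prod ba bb bf bg (ind1 A) (ind1 B) e01 Fe Ge.
have ff := sqerr_prod ba ba bf bf (ind1 A) (ind1 A) e01 Fe Fe.
have gg := sqerr_prod bb bb bg bg (ind1 B) (ind1 B) e01 Ge Ge.
have Ef : `|\int[P]_w \1_A w - \int[P]_w f w| <= e.
  rewrite -ler_sqr ?nnegrE ?(ltW egt0)// real_normK ?num_real//.
  exact: le_trans (sqr_Rintegral_le P ba bf) Fe.
have Eg : `|\int[P]_w \1_B w - \int[P]_w g w| <= e.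
  rewrite -ler_sqr ?nnegrE ?(ltW egt0)// real_normK ?num_real//.
  exact: le_trans (sqr_Rintegral_le P bb bg) Ge.
have indM (C C' : set T) : \int[P]_w (\1_C w * \1_C' w) = \int[P]_w \1_(C `&` C') w.
  by apply: eq_Rintegral => w _; rewrite indicI.
have mAB : measurable (A `&` B) by exact: measurableI.
move: fg ff gg Ef Eg; rewrite !indM !setIid !EP//.
have := tcov_corr rX linear_corr FD GD.
have cFG : \int[P]_w (f w * g w) =
    (\int[P]_w f w) * (\int[P]_w g w) + lin F (fun q => lin G (tcov r q)).
  exact: (Rintegral_tevalM gX cX rX F G).
have cFF : \int[P]_w (f w * f w) =
    (\int[P]_w f w) * (\int[P]_w f w) + lin F (fun q => lin F (tcov r q)).
  exact: (Rintegral_tevalM gX cX rX F F).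
have cGG : \int[P]_w (g w * g w) =
    (\int[P]_w g w) * (\int[P]_w g w) + lin G (fun q => lin G (tcov r q)).
  exact: (Rintegral_tevalM gX cX rX G G).
rewrite cFG cFF cGG.
have pA := probability_01 mA; have pB := probability_01 mB.
exact: covariance_perturbation.
Qed.

(** Replacing B by its complement changes the sign of P(A & B) - P(A) P(B), so the one-sided bound
    gives both sides. *)
Lemma mixing_event_le (A B : set T) : sigma_of X D1 A -> sigma_of X D2 B ->
  (`|P (A `&` B) - P A * P B| <= rho%:E)%E.
Proof.
move=> sA sB.
have mS (D : set I) (C : set T) : sigma_of X D C -> measurable C.
  move: C; apply: smallest_sub; first exact: sigma_algebra_measurable.
  by move=> _ [i _ [V mV <-]]; apply: (measurable_funPT (X i)).
have mA := mS _ _ sA; have mB := mS _ _ sB.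
have mAB : measurable (A `&` B) by exact: measurableI.
have mAC : measurable (A `&` ~` B) by apply: measurableI => //; exact: measurableC.
have sBC : sigma_of X D2 (~` B).
  have [_ C _] := @smallest_sigma_algebra T setT
    (\bigcup_(t in D2) preimage_set_system setT (X t) measurable).
  by have := C _ sB; rewrite setTD.
have h1 := covariance_event_le sA sB; have h2 := covariance_event_le sA sBC.
have fP C : measurable C -> P C = (fine (P C))%:E.
  by move=> mC; rewrite fineK// fin_num_measure.
have PC : fine (P (~` B)) = 1 - fine (P B).
  by rewrite probability_setC// (fP B).
have PAC : fine (P (A `&` ~` B)) = fine (P A) - fine (P (A `&` B)).
  rewrite -setDE measureD// ?fineB ?fin_num_measure//.
  by rewrite -ge0_fin_numE// fin_num_measure.
rewrite (fP A)// (fP B)// (fP (A `&` B))// -EFinM -EFinB abse_EFin lee_fin ler_norml.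
move: h1 h2; rewrite PC PAC; move: (fine _) (fine _) (fine _) => pa pb pab.
by move=> h1 h2; apply/andP; split; nra.
Qed.

End gaussian_mixing.

(** * Equality of laws from equality of covariances *)

Section same_law.
Context {R : realType} {I : eqType} d {T : measurableType d} (P : probability T R).
Context {Omega : Type}.
Variables (xi : I -> Omega -> R) (Phi : bool -> T -> Omega).
Variable X : bool -> I -> {RV P >-> R}.
Hypothesis xiX : forall j i w, xi i (Phi j w) = X j i w.
Hypothesis gX : forall j, gaussian_process (X j).
Hypothesis cX : forall j, centred (X j).
Variable r : I -> I -> R.
Hypothesis rX : forall j s t, ('E_P[X j s \* X j t] = (r s t)%:E)%E.

Lemma measurable_xi j i : measurable_fun setT (fun w => xi i (Phi j w)).
Proof. by under eq_fun do rewrite xiX; exact: measurable_funPT. Qed.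

Let cylinder_event (E : set Omega) :=
  <<s \bigcup_(i in [set: I]) preimage_set_system setT (xi i) measurable >> E.

Lemma measurable_cylinder_event E j : cylinder_event E -> measurable (Phi j @^-1` E).
Proof. by move=> /(approximable_sigma P measurable_xi)[]. Qed.

Lemma Rintegral_tfun (F : trig R I) j j' :
  \int[P]_w tfun xi F (Phi j w) = \int[P]_w tfun xi F (Phi j' w).
Proof.
have E k : \int[P]_w tfun xi F (Phi k w) = lin F (tmean r).
  rewrite -(Rintegral_teval (gX k) (cX k) (rX k)); apply: eq_Rintegral => w _.
  by rewrite /tfun; congr teval; apply/funext => i; exact: xiX.
by rewrite !E.
Qed.

Lemma sqerr_tfun (F G : trig R I) j j' :
  sqerr P (fun w => tfun xi F (Phi j w)) (fun w => tfun xi G (Phi j w)) =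
  sqerr P (fun w => tfun xi F (Phi j' w)) (fun w => tfun xi G (Phi j' w)).
Proof.
pose H := texp (F ++ tscale (-1) G) 2.
have E k : sqerr P (fun w => tfun xi F (Phi k w)) (fun w => tfun xi G (Phi k w)) =
    \int[P]_w tfun xi H (Phi k w).
  by apply: eq_Rintegral => w _; rewrite /tfun teval_exp teval_cat teval_scale mulN1r.
by rewrite !E; exact: Rintegral_tfun.
Qed.

(** Transfers the accuracy of a given [F] to another process of the same law, when [F] has to be
    fixed before that process is. With G accurate for both, two triangle inequalities give 2e + 2(2e
    + 2e) = 10e. *)
Lemma same_law_sqerr (E : set Omega) (F : trig R I) (e : R) j j' :
    cylinder_event E -> 0 < e ->
    sqerr P (\1_E \o Phi j) (fun w => tfun xi F (Phi j w)) <= e ->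
  sqerr P (\1_E \o Phi j') (fun w => tfun xi F (Phi j' w)) <= 10 * e.
Proof.
move=> cE e0 Fe; have [mE aE] := approximable_sigma P measurable_xi cE.
have [G _ Ge] := aE e e0.
have bE k : bounded_measurable (\1_E \o Phi k : T -> R) := bounded_measurable_event (mE k).
have bt K k := bounded_measurable_tfun measurable_xi K k.
have t1 := sqerr_triangle P (bE j') (bt G j') (bt F j').
have t2 := sqerr_triangle P (bt G j) (bE j) (bt F j).
have sym : sqerr P (fun w => tfun xi G (Phi j w)) (\1_E \o Phi j) =
    sqerr P (\1_E \o Phi j) (fun w => tfun xi G (Phi j w)).
  by apply: eq_Rintegral => w _; rewrite -sqrrN opprB.
move: t1 t2; rewrite sym (sqerr_tfun G F j' j).
have := Ge j; have := Ge j'; lra.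
Qed.

(** The expectations of trigonometric polynomials agree, and one polynomial approximates the event
    under both maps. *)
Lemma same_law (E : set Omega) j j' : cylinder_event E ->
  P (Phi j @^-1` E) = P (Phi j' @^-1` E).
Proof.
move=> cE; have [mE aE] := approximable_sigma P measurable_xi cE.
have bE k : bounded_measurable (\1_E \o Phi k : T -> R) := bounded_measurable_event (mE k).
have EP k : \int[P]_w (\1_E \o Phi k) w = fine (P (Phi k @^-1` E)).
  transitivity (\int[P]_w \1_(Phi k @^-1` E) w).
    by apply: eq_Rintegral => w _; rewrite /= !indicE.
  by rewrite /Rintegral integral_indic// setIT.
suff : fine (P (Phi j @^-1` E)) = fine (P (Phi j' @^-1` E)).
  by move=> h; rewrite -[LHS]fineK ?fin_num_measure// h fineK ?fin_num_measure.
apply/eqP; rewrite -subr_eq0 -normr_eq0 eq_le normr_ge0 andbT.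
apply/ler_addgt0Pr => e e0; rewrite add0r.
have e2 : 0 < (e / 2) ^+ 2 by rewrite exprn_gt0// divr_gt0.
have [F _ Fe] := aE _ e2.
have near k : `|fine (P (Phi k @^-1` E)) - \int[P]_w tfun xi F (Phi k w)| <= e / 2.
  rewrite -EP -ler_sqr ?nnegrE ?divr_ge0 ?(ltW e0)// real_normK ?num_real//.
  exact: le_trans (sqr_Rintegral_le P (bE k) (bounded_measurable_tfun measurable_xi F k)) (Fe k).
have := near j; have := near j'; rewrite (Rintegral_tfun F j j').
rewrite !ler_norml => /andP[? ?] /andP[? ?]; apply/andP; split; lra.
Qed.

End same_law.

(** * The Lamperti transform of sub-fractional Brownian motion *)

Section lamperti_process.
Context {R : realType} d {T : measurableType d} (P : probability T R).
Variables (H alpha : R) (S : {nonneg R} -> {RV P >-> R}).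
Hypotheses (H_gt0 : 0 < H) (H_lt1 : H < 1) (alpha_gt0 : 0 < alpha).
Hypothesis S_sub_fbm : sub_fbm H S.
Local Notation X := (lamperti H alpha S).

Let clock (t : R) : {nonneg R} := (expR (alpha * t))%:nng.

Lemma lampertiE t w : X t w = expR (- (alpha * H * t)) * S (clock t) w.
Proof. by rewrite /lamperti /= mulrC. Qed.

Lemma gaussian_lamperti : gaussian_process X.
Proof.
have [gS _ _] := S_sub_fbm => n t a.
have := gS n (fun i => clock (t i)) (fun i => a i * expR (- (alpha * H * t i))).
by under eq_fun do under eq_bigr do rewrite -mulrA -lampertiE.
Qed.

Definition lamperti_cov (s t : R) : R :=
  expR (- (alpha * H * s)) * expR (- (alpha * H * t)) *
  sub_fbm_cov H (expR (alpha * s)) (expR (alpha * t)).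

Lemma centred_lamperti : centred X.
Proof.
have [_ cS rS] := S_sub_fbm => t.
have iS := integrable_coord (r := fun s t => sub_fbm_cov H s%:num t%:num) rS (clock t).
rewrite unlock; under eq_integral do rewrite lampertiE EFinM.
rewrite integralZl//; have := cS (clock t); rewrite unlock => ->.
by rewrite mule0.
Qed.

Lemma cov_lamperti s t : ('E_P[X s \* X t] = (lamperti_cov s t)%:E)%E.
Proof.
have [_ _ rS] := S_sub_fbm.
have iS := integrable_coordM (r := fun s t => sub_fbm_cov H s%:num t%:num) rS (clock s) (clock t).
rewrite unlock (eq_integral (fun w => (expR (- (alpha * H * s)) * expR (- (alpha * H * t)))%:E *
  (S (clock s) w * S (clock t) w)%:E)%E); last first.
  by move=> w _; rewrite -EFinM mulrACA -!lampertiE.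
rewrite integralZl//; have := rS (clock s) (clock t); rewrite unlock => ->.
by rewrite -EFinM.
Qed.

Lemma powR_expR (x y : R) : expR x `^ y = expR (x * y).
Proof. by rewrite /powR gt_eqF ?expR_gt0// expRK mulrC. Qed.

(** The kernel is homogeneous of degree 2H, so a shift multiplies it by e^(2 alpha H h), which the
    two amplitudes cancel. *)
Lemma lamperti_cov_shift h s t : lamperti_cov (s + h) (t + h) = lamperti_cov s t.
Proof.
have clockD (x : R) : expR (alpha * (x + h)) = expR (alpha * h) * expR (alpha * x).
  by rewrite -expRD; congr expR; ring.
have ampD (x : R) : expR (- (alpha * H * (x + h))) =
    expR (- (alpha * H * h)) * expR (- (alpha * H * x)).
  by rewrite -expRD; congr expR; ring.
have one : expR (- (alpha * H * h)) * expR (- (alpha * H * h)) *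
    expR (alpha * h * (2 * H)) = 1.
  by rewrite -!expRD -[RHS]expR0; congr expR; ring.
rewrite /lamperti_cov !clockD !ampD sub_fbm_covZ ?expR_ge0// powR_expR.
set u := expR (- (alpha * H * h)) in one *; set v := expR (alpha * h * _) in one *.
move: (sub_fbm_cov _ _ _) (expR (- (alpha * H * s))) (expR (- (alpha * H * t))) => k x y.
rewrite (_ : u * x * (u * y) * (v * k) = (u * u * v) * (x * y * k)); last by ring.
by rewrite one mul1r.
Qed.

Definition shift_form (h : R) (l : seq (R * R)) : seq (R * R) :=
  [seq (p.1, p.2 + h) | p <- l].

Lemma bil_shift h l m :
  bil lamperti_cov (shift_form h l) (shift_form h m) = bil lamperti_cov l m.
Proof.
rewrite /bil lin_map [RHS]/lin; apply: eq_bigr => p _ /=.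
apply: (congr1 (fun x => p.1 * x)).
by rewrite lin_map [RHS]/lin; apply: eq_bigr => q _; rewrite lamperti_cov_shift.
Qed.

Definition to_sub_fbm (l : seq (R * R)) : seq (R * R) :=
  [seq (p.1 * expR (- (alpha * H * p.2)), expR (alpha * p.2)) | p <- l].

Lemma bil_to_sub_fbm l m : bil lamperti_cov l m =
  lin (to_sub_fbm l) (fun s => lin (to_sub_fbm m) (sub_fbm_cov H s)).
Proof.
rewrite /bil /to_sub_fbm lin_map; apply: eq_bigr => p _; rewrite /= -[RHS]mulrA; congr (_ * _).
rewrite lin_map mulr_sumr; apply: eq_bigr => q _ /=.
by rewrite /lamperti_cov; ring.
Qed.

(** Shifting by -a brings the times of [l] to e^(alpha t) <= 1 and those of [m] beyond T = e^(alpha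
    h), and h >= ln 2 / alpha means T >= 2. Then 2xy <= x^2 + y^2 gives the additive form. An
    arbitrary [a] is needed for ergodicity. *)
Lemma lamperti_linear_corr : exists2 C : R, 0 < C &
  forall a h : R, ln 2 / alpha <= h -> forall l m : seq (R * R),
    form_on [set t | t <= a] l -> form_on [set t | a + h <= t] m ->
  2 * bil lamperti_cov l m <= C * expR (- (lambda_S H alpha * h)) *
    (bil lamperti_cov l l + bil lamperti_cov m m).
Proof.
have [C C0 hC] := sub_fbm_linear_correlation H_gt0 H_lt1.
exists C => // a h hh l m la mh.
pose l' := to_sub_fbm (shift_form (- a) l); pose m' := to_sub_fbm (shift_form (- a) m).
have T2 : 2 <= expR (alpha * h).
  have : ln 2 <= alpha * h by rewrite mulrC -ler_pdivrMr.
  by rewrite -ler_expR lnK// posrE.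
have l1 : {in l', forall p, 0 < p.2 <= 1}.
  move=> _ /mapP[_ /mapP[p /la/= pa ->] ->] /=; rewrite expR_gt0/= expR_le1.
  by rewrite pmulr_rle0// subr_le0.
have mT : {in m', forall q, expR (alpha * h) <= q.2}.
  move=> _ /mapP[_ /mapP[p /mh/= pa ->] ->] /=; rewrite ler_expR ler_pM2l//.
  by lra.
have := hC _ _ _ T2 l1 mT.
rewrite powR_expR -bil_to_sub_fbm bil_shift mulrN /lambda_S [alpha * h * H]mulrAC.
have E n : kvar H (to_sub_fbm (shift_form (- a) n)) = bil lamperti_cov n n.
  by rewrite /kvar -bil_to_sub_fbm bil_shift.
rewrite !E => le1; have := le_trans (ler_norm _) le1.
have v n := bil_ge0 cov_lamperti n.
rewrite -{2}(sqr_sqrtr (v l)) -{2}(sqr_sqrtr (v m)).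
move: (Num.sqrt _) (Num.sqrt _) => x y; set c := C * _.
have c0 : 0 <= c by rewrite mulr_ge0 ?expR_ge0 ?ltW.
have : 0 <= c * (x - y) ^+ 2 by rewrite mulr_ge0 ?sqr_ge0.
nra.
Qed.

Lemma lamperti_mixing_rate : exists2 C : R, 0 < C &
  forall h : R, ln 2 / alpha <= h ->
    (alpha_mixing X h <= (C * expR (- (lambda_S H alpha * h)))%:E)%E.
Proof.
have [C C0 hC] := lamperti_linear_corr; exists C => // h hh.
apply: ge_ereal_sup => _ [A [B [sA sB ->]]].
apply: (mixing_event_le gaussian_lamperti centred_lamperti cov_lamperti _ _ sA sB).
  by rewrite mulr_ge0 ?expR_ge0 ?ltW.
move=> l m hl hm; apply: (hC 0) => // p /hm.
by rewrite /= add0r.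
Qed.

Lemma cvg_mixing_rate (c : R) :
  c * expR (- (lambda_S H alpha * h)) @[h --> +oo] --> 0.
Proof.
rewrite -(mulr0 c); apply: cvgMr.
apply: (@cvg_comp _ _ _ (fun h => lambda_S H alpha * h) (fun z => expR (- z)) _ (pinfty_nbhs R)).
  by apply: gt0_cvgMry; [exact: mulr_gt0|exact: cvg_id].
exact: cvgr_expR.
Qed.

Lemma lamperti_strongly_mixing : strongly_mixing X.
Proof.
have [C C0 hC] := lamperti_mixing_rate.
apply: (@squeeze_cvge _ _ _ _ (fun=> 0%E) _ (fun h => (C * expR (- (lambda_S H alpha * h)))%:E)).
- near=> h; apply/andP; split.
    (* The pair of empty events shows that the coefficient is nonnegative. *)
    apply: ereal_sup_ubound; exists set0, set0; split.
    + exact: sigma_algebra0.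
    + exact: sigma_algebra0.
    + by rewrite setI0 measure0 mule0 sube0 abse0.
  by apply: hC; near: h; apply: nbhs_pinfty_ge; exact: num_real.
- exact: cvg_cst.
- by apply: cvg_EFin; [exact: nearW|exact: cvg_mixing_rate].
Unshelve. all: by end_near. Qed.

(** The process and its shift as one family. The lemmas below reindex it by an arbitrary [t], to
    cover both finitely many times and whole paths. *)
Let shifted (h : R) (j : bool) (t : R) : {RV P >-> R} := if j then X (t + h) else X t.

Let gaussian_shifted h (I : eqType) (t : I -> R) j :
  gaussian_process (fun i => shifted h j (t i)).
Proof.
rewrite /shifted; case: j => n u a.
  exact: (gaussian_lamperti (fun i => t (u i) + h) a).
exact: (gaussian_lamperti (fun i => t (u i)) a).
Qed.

Let centred_shifted h (I : eqType) (t : I -> R) j :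
  centred (fun i => shifted h j (t i)).
Proof. by rewrite /shifted; case: j => i; exact: centred_lamperti. Qed.

Let cov_shifted h (I : eqType) (t : I -> R) j i i' :
  ('E_P[shifted h j (t i) \* shifted h j (t i')] = (lamperti_cov (t i) (t i'))%:E)%E.
Proof.
by rewrite /shifted; case: j; rewrite cov_lamperti ?lamperti_cov_shift.
Qed.

Lemma stationary_lamperti : stationary X.
Proof.
move=> n t h B mB.
pose xi (i : 'I_n) (x : n.-tuple R) : R := tnth x i.
pose Phi (j : bool) (w : T) : n.-tuple R := [tuple shifted h j (t i) w | i < n].
have xiX j i w : xi i (Phi j w) = shifted h j (t i) w by rewrite /xi tnth_mktuple.
apply: (same_law xiX (gaussian_shifted h t) (centred_shifted h t) (cov_shifted h t) true false).
(* The generator of the product sigma-algebra on tuples is an iterated union over the coordinates,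
   to be turned into an indexed one. *)
apply: (@sub_sigma_algebra2 _ setT _ _ _ B mB) => V.
by apply: (big_ind (fun M : set (set (n.-tuple R)) => M V ->
  (\bigcup_(i in [set: 'I_n]) preimage_set_system setT (xi i) measurable) V)) =>
  [//|M M' hM hM' [/hM|/hM']//|i _ iV]; exists i.
Qed.

Lemma trig_on_bounded (F : trig R R) : exists a : R, trig_on [set t | - a <= t <= a] F.
Proof.
have form_bounded (l : seq (R * R)) : exists a : R, form_on [set t | `|t| <= a] l.
  elim: l => [|p l [a ha]]; first by exists 0.
  exists (Num.max `|p.2| a) => q; rewrite inE => /orP[/eqP ->|/ha qa] /=.
    by rewrite le_max lexx.
  by rewrite le_max qa orbT.
suff [a ha] : exists a : R, trig_on [set t | `|t| <= a] F.
  by exists a => q /ha h p /h /=; rewrite ler_norml.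
elim: F => [|q F [a ha]]; first by exists 0.
have [b hb] := form_bounded q.2.1.
exists (Num.max a b) => q'; rewrite inE => /orP[/eqP -> p /hb|/ha h p /h] /= pb.
  by rewrite le_max pb orbT.
by rewrite le_max pb.
Qed.

(** The event equals its shift almost surely, so its probability p is that of its intersection with
    a far shift, which is close to p^2 by decorrelation. This gives p <= p^2, hence p = 0 or p = 1.
    The polynomial is fixed first; its finitely many times then determine how far to shift. *)
Lemma ergodic_lamperti : ergodic X.
Proof.
move=> E cE inv.
pose xi (t : R) (x : R -> R) : R := x t.
pose Phi (h : R) (j : bool) (w : T) : R -> R :=
  if j then time_shift h (sample_path X w) else sample_path X w.
have xiX h j t w : xi t (Phi h j w) = shifted h j t w.
  by rewrite /Phi /shifted; case: j.
have gS h := gaussian_shifted h id; have cS h := centred_shifted h id.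
have rS h := cov_shifted h id.
pose mxi h := measurable_xi (xiX h).
have [_ aE] := approximable_sigma P (mxi 0) cE.
have mPhi h j : measurable (Phi h j @^-1` E).
  exact: (measurable_cylinder_event (xiX h) j cE).
set A := sample_path X @^-1` E.
have mA : measurable A := mPhi 0 false.
pose p := fine (P A).
have p01 : 0 <= p <= 1.
  by rewrite fine_ge0//= -lee_fin fineK ?fin_num_measure// probability_le1.
suff pp : p <= p ^+ 2.
  have : p * (1 - p) = 0.
    by apply/eqP; rewrite eq_le; case/andP: p01 => p0 p1; apply/andP; split; nra.
  have PA : P A = p%:E by rewrite fineK// fin_num_measure.
  move=> /eqP; rewrite mulf_eq0 => /orP[/eqP p0|/eqP p1].
    by left; rewrite PA p0.
  by right; rewrite PA; congr EFin; lra.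
apply/ler_addgt0Pr => e0 e0_gt0.
(* The error 7e is made up of 3e for the product, e for the covariance and 3e for replacing the
   squared mean by p^2. *)
pose e := Num.min 1 (e0 / 7).
have egt0 : 0 < e by rewrite lt_min ltr01 divr_gt0.
have e1 : e <= 1 by rewrite ge_min lexx.
have e7 : e * 7 <= e0 by rewrite -ler_pdivlMr// ge_min lexx orbT.
(* The division by 10 offsets the loss in [same_law_sqerr]. *)
have e10 : 0 < e ^+ 2 / 10 by rewrite divr_gt0 ?exprn_gt0.
have [F _ /(_ false) Fe] := aE _ e10.
have [a Fa] := trig_on_bounded F.
have [C C0 hC] := lamperti_linear_corr.
have N0 := tnorm_ge0 F; set N := tnorm F in N0.
have [h1 [h1l h1e]] : exists h1 : R, ln 2 / alpha <= h1 /\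
    C * N ^+ 2 * expR (- (lambda_S H alpha * h1)) <= e.
  have /cvgrPdist_le/(_ e egt0) cv := cvg_mixing_rate (C * N ^+ 2).
  have [h1 [hl hr]] := filter_ex (filterI (nbhs_pinfty_ge (num_real (ln 2 / alpha))) cv).
  by exists h1; split=> //; move: hr; rewrite sub0r normrN; apply: le_trans; exact: ler_norm.
(* The times of F lie in [-a, a], so those of its shift are at least a + h1, at distance h1 from the
   former. *)
pose h := 2 * a + h1.
pose G := treindex (fun t => t + h) F.
have GE w : tfun xi G (sample_path X w) = tfun xi F (Phi h true w).
  by rewrite /tfun teval_reindex.
have FD : trig_on [set t | t <= a] F by move=> q /Fa hq t /hq /andP[].
have GD : trig_on [set t | a + h1 <= t] G.
  move=> _ /mapP[q /Fa hq ->] _ /mapP[t /hq /andP[ta _] ->] /=.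
  by rewrite /h; lra.
pose f w := tfun xi F (sample_path X w).
pose g w := tfun xi F (Phi h true w).
have bf : bounded_measurable f := bounded_measurable_tfun (mxi h) F false.
have bg : bounded_measurable g := bounded_measurable_tfun (mxi h) F true.
have mA' : measurable (Phi h true @^-1` E) := mPhi h true.
have e2 : e ^+ 2 / 10 <= e ^+ 2 by have := exprn_gt0 2 egt0; lra.
have Fe2 := le_trans Fe e2.
have Ge2 : sqerr P (\1_E \o Phi h true) g <= e ^+ 2.
  apply: (le_trans (@same_law_sqerr _ _ _ _ P _ _ _ _ (xiX h) (gS h) (cS h) _ (rS h)
    E F _ false true cE e10 Fe)).
  by rewrite mulrC divfK.
have bA k : bounded_measurable (\1_E \o Phi h k : T -> R) := bounded_measurable_event (mPhi h k).
have ind1 k w : `|(\1_E \o Phi h k) w| <= 1 :> R.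
  by rewrite /= indicE; case: (_ \in _); rewrite ?normr1 ?normr0.
have e01 : 0 <= e <= 1 by rewrite ltW.
have := sqerr_prod (bA false) (bA true) bf bg (ind1 false) (ind1 true) e01 Fe2 Ge2.
(* Invariance enters here: A minus the shifted event is null, so the intersection of the two has
   probability p. *)
have -> : \int[P]_w ((\1_E \o Phi h false) w * (\1_E \o Phi h true) w) = p.
  transitivity (\int[P]_w \1_(A `&` Phi h true @^-1` E) w).
    by apply: eq_Rintegral => w _; rewrite indicI /= !indicE.
  rewrite /Rintegral integral_indic ?setIT//; last exact: measurableI.
  rewrite /p -/A (@measureDI _ _ _ P A (Phi h true @^-1` E))//.
  rewrite [X in (X + _)%E](_ : _ = 0%E) ?add0e//.
  have mD : measurable (sample_path X @^-1` (E `+` time_shift h @^-1` E)).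
    have -> : sample_path X @^-1` (E `+` time_shift h @^-1` E) =
        (A `\` Phi h true @^-1` E) `|` (Phi h true @^-1` E `\` A) by [].
    by apply: measurableU; exact: measurableD.
  apply/eqP; rewrite -measure_le0 -(inv h) le_measure ?inE//.
    exact: measurableD.
  by move=> w Aw; left.
have pf : `|p - \int[P]_w f w| <= e.
  have <- : \int[P]_w (\1_E \o Phi h false) w = p.
    transitivity (\int[P]_w \1_A w); first by apply: eq_Rintegral => w _; rewrite /= !indicE.
    by rewrite /Rintegral integral_indic// setIT.
  rewrite -ler_sqr ?nnegrE ?(ltW egt0)// real_normK ?num_real//.
  exact: le_trans (sqr_Rintegral_le P (bA false) bf) Fe2.
have cov K L := Rintegral_tevalM gaussian_lamperti centred_lamperti cov_lamperti K L.
have fgE : \int[P]_w (f w * g w) = (\int[P]_w f w) * (\int[P]_w f w) +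
    lin F (fun q => lin G (tcov lamperti_cov q)).
  have gE : \int[P]_w teval G (fun i => X i w) = \int[P]_w f w.
    under eq_Rintegral do rewrite -[teval G _]/(tfun xi G (sample_path X _)) GE.
    exact: (Rintegral_tfun (xiX h) (gS h) (cS h) (rS h) F true false).
  rewrite -{2}gE -(cov F G); apply: eq_Rintegral => w _; congr (_ * _).
  by rewrite /g -GE.
have var K : tnorm K = N -> lin K (fun q => lin K (tcov lamperti_cov q)) <= N ^+ 2.
  move=> KN; have bK := integrable_teval P K (fun t => measurable_funPT (X t)).
  have := cov K K; set m := \int[P]_w teval K _; set v := lin K _ => h2.
  have : \int[P]_w (teval K (fun i => X i w) * teval K (fun i => X i w)) <= N ^+ 2.
    have -> : N ^+ 2 = \int[P]_w (N ^+ 2).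
      by rewrite Rintegral_cst// [X in fine X]probability_setT mulr1.
    have bt := bounded_measurable_tfun (mxi h) K false.
    apply: le_Rintegral => //.
    - exact: (bounded_measurable_integrable P (bounded_measurableM bt bt)).
    - exact: finite_measure_integrable_cst.
    - move=> w _; rewrite -expr2 -real_normK ?num_real// lerXn2r ?nnegrE//.
      by rewrite -KN teval_le.
  by rewrite h2; apply: le_trans; rewrite lerDr -expr2 sqr_ge0.
have := tcov_corr cov_lamperti (hC a h1 h1l) FD GD.
have NG : tnorm G = N by rewrite /tnorm big_map.
have := var F erefl; have := var G NG.
rewrite fgE; set tFG := lin F (fun q => lin G _); set tFF := lin F (fun q => lin F _).
set tGG := lin G _; move: pf; set mf := \int[P]_w f w; set rho := C * expR _.
have rho0 : 0 <= rho by rewrite mulr_ge0 ?expR_ge0 ?ltW.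
have rhoN : rho * N ^+ 2 <= e by rewrite /rho mulrAC.
rewrite !ler_norml => /andP[u1 u2] v1 v2 v3 /andP[w1 w2].
have t1 : tFG <= e.
  have : rho * (tFF + tGG) <= rho * (N ^+ 2 + N ^+ 2) by rewrite ler_wpM2l// lerD.
  by move: v3 rhoN; clear; lra.
have mf2 : mf ^+ 2 <= p ^+ 2 + 3 * e.
  have mf_le : `|mf| <= p + e.
    case/andP: p01 => p0 _; rewrite ler_norml; move: u1 u2 p0 egt0; clear.
    by move=> *; apply/andP; split; lra.
  have : `|mf| ^+ 2 <= (p + e) ^+ 2 by rewrite lerXn2r// nnegrE (le_trans _ mf_le).
  rewrite real_normK ?num_real//; case/andP: p01 => p0 p1.
  by move: p0 p1 egt0 e1; clear; nra.
by move: w1 e7 t1 mf2; rewrite expr2; clear; lra.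
Qed.

End lamperti_process.

Unset Implicit Arguments.
Set Strict Implicit.
Set Printing Implicit Defensive.

Theorem theorem2p8 (R : realType) (d : measure_display) (T : measurableType d)
    (P : probability T R) (H alpha : R) (S : {nonneg R} -> {RV P >-> R})
    (H_gt0 : 0 < H) (H_lt1 : H < 1) (alpha_gt0 : 0 < alpha)
    (S_sub_fbm : sub_fbm H S) :
  [/\ gaussian_process (lamperti H alpha S),
      stationary (lamperti H alpha S),
      ergodic (lamperti H alpha S),
      strongly_mixing (lamperti H alpha S) &
      exists C : R, 0 < C /\
        \forall h \near +oo,
          (alpha_mixing (lamperti H alpha S) h <=
             (C * expR (- (lambda_S H alpha * h)))%:E)%E].
Proof.
have [C C_gt0 hC] := lamperti_mixing_rate H_gt0 H_lt1 alpha_gt0 S_sub_fbm.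
split.
- exact: gaussian_lamperti.
- exact: stationary_lamperti.
- exact: ergodic_lamperti.
- exact: lamperti_strongly_mixing.
exists C; split=> //; near=> h; apply: hC; near: h.
by apply: nbhs_pinfty_ge; exact: num_real.
Unshelve. all: by end_near.
Qed.
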